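(* Let $X$ and $Y$ be two Banach spaces and assume that $f:X\to Y$ is a bijection such that $Lip(f)\le 1$ and $Lip(f^{-1})\le M$. Then there exists an equivalent norm $|\ |$ on $Y$ such that $\|\ \|_Y\le |\ |\le M\|\ \|_Y$ and $$\forall t\in [0,1]\qquad \overline{\theta}_{|\ |}(t)\ge \overline{\theta}_X\Big(\frac{t}{4M}\Big).$$
   Context: $Lip(f)$ denotes the Lipschitz constant of $f$. For a Banach space $Z$ with dual norm on $Z^*$, $t>0$ and $z^*\in S_{Z^*}$ (unit sphere of $Z^*$): $\overline{\theta}_Z(z^*,t)=\sup_{E}\inf_{w^*\in S_{E^\perp}}(\|z^*+tw^*\|-1)$, where $E$ runs through all finite dimensional subspaces of $Z$, $E^\perp\subset Z^*$ is the annihilator of $E$ and $S_{E^\perp}$ its unit sphere; and $\overline{\theta}_Z(t)=\inf_{z^*\in S_{Z^*}}\overline{\theta}_Z(z^*,t)$ (with value $0$ at $t=0$). $\overline{\theta}_{|\ |}$ denotes this modulus for the Banach space $(Y,|\ |)$, computed with the dual norm of $|\ |$ on $Y^*$. *)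

(* Defs.v *)
From HB Require Import structures.
From mathcomp Require Import all_boot all_order all_algebra.
From mathcomp Require Import all_classical all_reals all_analysis.

Set Implicit Arguments.
Unset Strict Implicit.
Unset Printing Implicit Defensive.

Import Order.TTheory GRing.Theory Num.Theory.
Import numFieldNormedType.Exports.

Local Open Scope classical_set_scope.
Local Open Scope ring_scope.

(* The infimum is +oo when f is not Lipschitz. *)
Definition Lip (R : realType) (V W : normedModType R) (f : V -> W) : \bar R :=
  ereal_inf [set k%:E | k in [set k : R | 0 <= k /\ k.-lipschitz f]].

(* A norm is a function N on the underlying real vector space, so that the
   same definitions apply to the given norm of a Banach space and to a
   renorming of it. *)
Section NormedSpace.
Context {R : realType} {V : lmodType R}.
Implicit Types (N : V -> R) (phi z w : V -> R) (E : set V) (t : R).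

Definition is_norm N : Prop :=
  [/\ forall x, 0 <= N x,
      forall x, N x = 0 -> x = 0,
      forall x y, N (x + y) <= N x + N y
    & forall (a : R) x, N (a *: x) = `|a| * N x].

Definition equivalent_norms N1 N2 : Prop :=
  exists a b : R, [/\ 0 < a, 0 < b & forall x, a * N1 x <= N2 x <= b * N1 x].

Definition dual N : set (V -> R) :=
  [set phi | scalar phi /\ exists C : R, forall x, `|phi x| <= C * N x].

Definition dual_norm N phi : \bar R :=
  ereal_sup [set `|phi x|%:E | x in [set x | N x <= 1]].

Definition dual_sphere N : set (V -> R) :=
  dual N `&` [set phi | dual_norm N phi = 1%E].

Definition annihilator N E : set (V -> R) :=
  dual N `&` [set phi | forall x, E x -> phi x = 0].

Definition fin_dim_subspace E : Prop :=
  exists n (e : 'I_n -> V), E = range (fun a : 'I_n -> R => \sum_i a i *: e i).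

(* Extended-real values: if V is finite dimensional, then E = V is allowed, the
   sphere of its annihilator is empty, and the infimum over it is +oo. *)
Definition theta_bar_at N z t : \bar R :=
  ereal_sup
    [set ereal_inf
           [set (dual_norm N (fun x => (z x + t * w x)%R) - 1)%E
           | w in annihilator N E `&` dual_sphere N]
    | E in fin_dim_subspace].

Definition theta_bar N t : \bar R :=
  if t == 0 then 0%E
  else ereal_inf [set theta_bar_at N z t | z in dual_sphere N].

End NormedSpace.

(* Main.v *)
Require Import Defs.
From HB Require Import structures.
From mathcomp Require Import all_boot all_order all_algebra.
From mathcomp Require Import all_classical all_reals all_analysis.
From mathcomp Require Import ring lra.

Import Order.TTheory GRing.Theory Num.Theory.
Import numFieldNormedType.Exports.

Local Open Scope classical_set_scope.
Local Open Scope ring_scope.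

(** For a functional [u] on [Y] let [|u|] be the Lipschitz constant of [u \o f].
    This is the dual norm of an equivalent norm on [Y], [lip_norm], and that
    norm satisfies the theorem. Fix [t], put [s = t / (4 M)], and let [th] be
    smaller than the modulus of [X] at [s]. Given [u] with [|u| = 1], the task is
    to show that for all [w] with [|w| = 1] that vanish on a suitable finite
    dimensional subspace of [Y], the function [(u + t w) \o f] has two points
    with slope at least [1 + th]. Let [h = u \o f] and [sg = th / s].

    - Duality in [X]. By weak-star compactness of the dual ball, a functional
      that norms [x + z], with [z] in a subspace of finite codimension chosen
      from [x], is nearly [p + q] with [p z = 0] and [q] vanishing on a finite
      dimensional space which depends on [p]; the assumption on the modulus of
      [X] then makes [p] small when [q] is large. This is [asymptotic_norm].
      It gives [|x + z| <= |x| (1 + th - sg th)] up to a small error as soon as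
      [|z| <= sg |x|] ([asymptotic_growth]), and it shows that averages of
      suitably many vectors of norm at most [1], each chosen in a subspace of
      finite codimension that depends on the previous ones, are as small as
      desired ([forced_average]).

    - Choice of the pair of points ([good_point]). There are [m] and [v] such
      that [h] has slope almost [1] between [m] and [m + v], while
      [h (m + z) - h m] is at most an arbitrarily small multiple of [|v|] when
      [|z| <= sg |v|] and [z] is in some subspace of finite codimension.
      Otherwise one starts in the middle of a very long segment on which [h]
      has slope almost [1] and repeatedly moves by some [z] that increases [h].
      The translated segments still have slope almost [1], because their length
      is much larger than the displacement. After [n] moves, the gain of [h] is
      proportional to [n] and the displacement is a small multiple of [n]; this
      is impossible since [h] is 1-Lipschitz.

    - The Gorelik principle ([gorelik]). For [b < sg |v| / (2 M)], a vector [y]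
      of norm at most [b] on which [w] is close to [- b] is [f (m + z) - f (m + a)]
      with [z] in the given subspace of finite codimension, [|z| <= sg |v|], and
      [a] in a compact set which does not depend on [y] nor [w]. As [w] is
      negligible on the image of a compact set, [w (f (m + z) - f m)] is about
      [- sg |v| / (2 M)]. The existence of [a] and [z] is a topological fact akin
      to Brouwer's fixed point theorem: it is derived from
      [cube_complementarity], a variational inequality on the cube, and
      ultimately from a combinatorial lemma of Kuhn.

    Comparing the values of [(u + t w) \o f] at [m + v] and [m + z], their
    difference is about [|v| (1 + t sg / (2 M)) = |v| (1 + 2 th)], and the distance
    between the points is at most [|v| (1 + th - sg th)]. The quotient is larger
    than [1 + th] because [th < sg], that is, because [s < 1]. *)


(** * Kuhn's lemma on labelled grids *)

Section Kuhn.
Local Set Implicit Arguments.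
Local Unset Strict Implicit.
Variable n : nat.
Local Notation point := {ffun 'I_n -> nat}.
Local Notation label := (point -> 'F_2).
Implicit Types (J : {set 'I_n}) (i j l : 'I_n) (ls : seq 'I_n) (v u : point).

Definition bump v j : point := [ffun i => (v i + (i == j))%N].
Definition upd v j c : point := [ffun i => if i == j then c else v i].

Lemma F2_addxx (x : 'F_2) : x + x = 0.
Proof. by rewrite -mulr2n -mulr_natr; apply/eqP; rewrite mulf_eq0 orbT. Qed.

Lemma bumpC v i j : bump (bump v i) j = bump (bump v j) i.
Proof. by apply/ffunP => k; rewrite !ffunE addnAC. Qed.

Lemma sum_sym_F2 J (a : 'I_n -> 'I_n -> 'F_2) :
  (forall i j, a i j = a j i) -> \sum_(j in J) \sum_(i in J :\ j) a j i = 0.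
Proof.
move=> asym.
have E : \sum_(j in J) \sum_(i in J :\ j) a j i =
  \sum_(j in J) \sum_(i in J | (i < j)%N) a j i + \sum_(j in J) \sum_(i in J | (j < i)%N) a j i.
  rewrite -big_split; apply: eq_bigr => j _ /=.
  rewrite (bigID (fun i : 'I_n => (i < j)%N)) /=; congr (_ + _); apply: eq_bigl => i;
  rewrite !inE andbAC -?leqNgt -1?andbA -val_eqE /= 1?andbC;
    first by case: ltngtP; rewrite ?andbF ?andbT.
  by case: ltngtP; rewrite ?andbF ?andbT.
rewrite E (exchange_big_dep (fun i => i \in J)) /=; last by move=> j i _ /andP[].
rewrite -big_split /= big1 // => i iJ.
rewrite (eq_bigl (fun j => (j \in J) && (i < j)%N)); last by move=> j; rewrite iJ.
rewrite -big_split /= big1 // => j _.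
by rewrite asym F2_addxx.
Qed.

Variable L : 'I_n -> label.

(** The sum, over all monotone lattice paths that leave [v] along the directions
    in [J], of the product of the changes of the labels [ls] on the successive
    edges: the value on the cube [v + [0, 1]^J] of the cup product of the
    coboundaries of the labels, computed on its Freudenthal triangulation. *)
Fixpoint paths J ls v : 'F_2 :=
  if ls is l :: ls' then
    \sum_(j in J) (L l (bump v j) + L l v) * paths (J :\ j) ls' (bump v j)
  else 1.

Lemma setD1C J i j : J :\ i :\ j = J :\ j :\ i.
Proof. by apply/setP => k; rewrite !inE andbCA. Qed.

(** The cup product of coboundaries is a cocycle: the facets of a cell that contain
    its least vertex and those that do not have the same total. Modulo 2, the
    terms where an intermediate vertex moves cancel in pairs, since two
    directions can be travelled in either order. *)
Lemma paths_cocycle ls J v : #|J| = (size ls).+1 ->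
  \sum_(j in J) paths (J :\ j) ls (bump v j) = \sum_(j in J) paths (J :\ j) ls v.
Proof.
elim: ls J v => [|l ls IH] J v /= cJ; first by [].
have cJ' j : j \in J -> #|J :\ j| = (size ls).+1.
  by move=> jJ; move: cJ; rewrite (cardsD1 j) jJ => -[].
under eq_bigr => j jJ.
  under eq_bigr => i _ do rewrite mulrDl.
  rewrite big_split /= -mulr_sumr IH ?cJ' //.
  over.
rewrite big_split /= sum_sym_F2 ?add0r; last first.
  by move=> i j; rewrite bumpC setD1C.
under [RHS]eq_bigr => j jJ.
  under eq_bigr => i _ do rewrite mulrDl.
  rewrite big_split /= -[X in _ + X]mulr_sumr IH ?cJ' //.
  over.
rewrite big_split /= -mulr_sumr.
rewrite [X in L l v * X]sum_sym_F2 ?mulr0 ?addr0; last by move=> i j; rewrite setD1C.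
under eq_bigr do rewrite mulr_sumr.
rewrite (exchange_big_dep (fun i => i \in J)) /=; last by move=> j i _; rewrite !inE => /andP[].
apply: eq_bigr => j jJ; apply: eq_big => [i|i _]; last by rewrite setD1C.
by rewrite !inE jJ eq_sym andbT andbC.
Qed.

Variable k : nat.

Fixpoint box (js : seq 'I_n) (F : label) v : 'F_2 :=
  if js is j :: js' then \sum_(c < k) box js' F (upd v j c) else F v.

Lemma eq_box js (F G : label) v : F =1 G -> box js F v = box js G v.
Proof. by move=> FG; elim: js v => //= j js IH v; apply: eq_bigr. Qed.

Lemma box_sum js (I : Type) (r : seq I) (P : pred I) (F : I -> label) v :
  box js (fun w => \sum_(i <- r | P i) F i w) v = \sum_(i <- r | P i) box js (F i) v.
Proof.
elim: js v => //= j js IH v; rewrite exchange_big /=; apply: eq_bigr => c _; exact: IH.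
Qed.

Lemma box_add js (F G : label) v :
  box js (fun w => F w + G w) v = box js F v + box js G v.
Proof. by elim: js v => //= j js IH v; rewrite -big_split; apply: eq_bigr => c _; exact: IH. Qed.

Lemma updC v i j c d : i != j -> upd (upd v i c) j d = upd (upd v j d) i c.
Proof.
move=> ij; apply/ffunP => a; rewrite !ffunE; case: eqP => // ->.
by rewrite eq_sym (negbTE ij).
Qed.

Lemma box_rem js j F v : uniq js -> j \in js ->
  box js F v = \sum_(c < k) box (rem j js) F (upd v j c).
Proof.
elim: js v => //= i js IH v /andP[ijs ujs]; rewrite inE eq_sym.
have [-> // | ij /= jjs] := eqVneq i j.
under eq_bigr do rewrite IH //.
rewrite exchange_big /=; apply: eq_bigr => c _; apply: eq_bigr => d _.
by rewrite updC.
Qed.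

Lemma box_coord js j (F : label) (c : nat) v : j \notin js ->
  (forall w : point, w j = c -> F w = 0) -> v j = c -> box js F v = 0.
Proof.
move=> + F0; elim: js v => [|i js IH] v /=; first by move=> _; exact: F0.
rewrite inE negb_or => /andP[ji jjs] vj; rewrite big1 // => d _.
by apply: IH => //; rewrite ffunE (negbTE ji).
Qed.

Lemma box_ext js j (F G : label) (c : nat) v : j \notin js ->
  (forall w : point, w j = c -> F w = G w) -> v j = c -> box js F v = box js G v.
Proof.
move=> + F0; elim: js v => [|i js IH] v /=; first by move=> _; exact: F0.
rewrite inE negb_or => /andP[ji jjs] vj; apply: eq_bigr => d _.
by apply: IH => //; rewrite ffunE (negbTE ji).
Qed.

(** Telescoping in the direction [j] leaves the two faces orthogonal to it. *)
Lemma box_bump js j (F : label) v : uniq js -> j \in js ->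
  box js (fun w => F (bump w j)) v + box js F v =
  box (rem j js) F (upd v j k) + box (rem j js) F (upd v j 0).
Proof.
move=> ujs jjs; rewrite !(box_rem _ _ ujs jjs).
have jr : j \notin rem j js by rewrite mem_rem_uniq // !inE eqxx.
have E (c : nat) : box (rem j js) (fun w => F (bump w j)) (upd v j c) =
    box (rem j js) F (upd v j c.+1).
  move: jr; elim: (rem j js) v => [|i r IH] u /=.
    by move=> _; congr F; apply/ffunP => a; rewrite !ffunE; case: eqP; rewrite ?addn1 ?addn0.
  rewrite inE negb_or eq_sym => /andP[ij jr]; apply: eq_bigr => d _.
  by rewrite -!(updC _ _ _ ij) -IH.
under eq_bigr do rewrite E.
move: (box (rem j js) F) => B.
elim: k => [|m IH]; first by rewrite !big_ord0 addr0 F2_addxx.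
rewrite !big_ord_recr /= addrACA IH [X in X + _]addrC addrACA.
by rewrite F2_addxx addr0 addrC.
Qed.

(** A label which is constant on a hyperplane kills the paths inside it. *)
Lemma paths_const ls J l j (c : nat) (a : 'F_2) v : j \notin J ->
  l \in ls -> (forall w : point, w j = c -> L l w = a) -> v j = c -> paths J ls v = 0.
Proof.
move=> + + la; elim: ls J v => //= l' ls IH J v jJ lls vj.
rewrite big1 // => i iJ.
have ij : (j == i) = false by apply/negbTE; apply: contra jJ => /eqP ->.
have bj : bump v i j = c by rewrite ffunE ij addn0.
rewrite inE in lls; case/orP: lls => [/eqP <-|lls]; first by rewrite !la // F2_addxx mul0r.
by rewrite IH ?mulr0 // !inE (negbTE jJ) andbF.
Qed.

(** Stokes' formula and induction on the dimension: the sum over the cube of the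
    cup product reduces to its boundary, where only the face on which the first
    label equals 1 contributes. *)
Lemma kuhn_sum js v : uniq js ->
  (forall j (w : point), w j = 0%N -> L j w = 0) ->
  (forall j (w : point), w j = k -> L j w = 1) ->
  box js (paths [set j in js] js) v = 1.
Proof.
move=> ujs L0 L1; elim: js v ujs => //= j1 js IH v /andP[j1js ujs].
set J := [set j in j1 :: js].
have ujs1 : uniq (j1 :: js) by rewrite /= j1js.
have cJ : #|J| = (size js).+1 by rewrite cardsE (card_uniqP ujs1).
pose F j : label := fun w => L j1 w * paths (J :\ j) js w.
have -> : \sum_(c < k) box js (fun w => \sum_(j in J) (L j1 (bump w j) + L j1 w) *
     paths (J :\ j) js (bump w j)) (upd v j1 c) =
  box (j1 :: js) (fun w => \sum_(j in J) (F j (bump w j) + F j w)) v.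
  apply: eq_bigr => c _; apply: eq_box => w.
  under eq_bigr do rewrite mulrDl.
  by rewrite !big_split /= -!mulr_sumr paths_cocycle.
rewrite box_sum (bigD1 j1) ?inE ?eqxx //= [X in _ + X]big1 ?addr0; last first.
  move=> j; rewrite !inE => /andP[jJ jj1].
  have jjs : j \in js by case/orP: jJ => // /eqP jE; rewrite jE eqxx in jj1.
  have := @box_add (j1 :: js) (fun w => F j (bump w j)) (F j) v => /= ->.
  have := @box_bump (j1 :: js) j (F j) v ujs1 => /= ->; last by rewrite inE jjs orbT.
  have jr : j \notin rem j (j1 :: js) by rewrite mem_rem_uniq // !inE eqxx.
  have jJD : j \notin J :\ j by rewrite !inE eqxx.
  rewrite /= in jr.
  have Z c a : (forall w : point, w j = c -> L j w = a) ->
      box (if j1 == j then js else j1 :: rem j js) (F j) (upd v j c) = 0.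
    move=> la; apply: (@box_coord _ j _ c) => // [w wj|]; last by rewrite ffunE eqxx.
    by rewrite /F (paths_const jJD jjs la) ?mulr0.
  by rewrite (Z _ _ (L0 j)) (Z _ _ (L1 j)) addr0.
have := @box_add (j1 :: js) (fun w => F j1 (bump w j1)) (F j1) v => /= ->.
have := @box_bump (j1 :: js) j1 (F j1) v ujs1 => /= ->; last by rewrite inE eqxx.
rewrite eqxx [X in _ + X](@box_coord _ j1 _ 0%N) ?addr0 //; last 2 first.
- by move=> w wj; rewrite /F L0 ?mul0r.
- by rewrite ffunE eqxx.
rewrite (@box_ext _ j1 _ (paths [set j in js] js) k) ?IH ?ffunE ?eqxx // => w wj.
rewrite /F L1 // mul1r; congr (paths _ _ _); apply/setP => i; rewrite !inE.
by case: eqP => // ->; rewrite (negbTE j1js).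
Qed.

Lemma box_neq0 js (F : label) v : box js F v != 0 ->
  exists w, [/\ F w != 0, forall j, j \in js -> (w j < k)%N
    & forall j, j \notin js -> w j = v j].
Proof.
elim: js v => [|i js IH] v /=; first by exists v.
move=> H; have [c Hc] : exists c : 'I_k, box js F (upd v i c) != 0.
  apply/existsP; apply: contraR H; rewrite negb_exists => /forallP Z.
  by rewrite big1 // => c _; apply/eqP; have := Z c; rewrite negbK.
have [w [Fw w1 w2]] := IH _ Hc; exists w; split=> // j; rewrite inE.
  case/orP => [/eqP ->|/w1 //]; have [/w1 //|/w2 ->] := boolP (i \in js).
  by rewrite ffunE eqxx.
by rewrite negb_or => /andP[ji /w2 ->]; rewrite ffunE (negbTE ji).
Qed.

Lemma paths_neq0 ls J v l : paths J ls v != 0 -> l \in ls ->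
  exists u u', [/\ L l u != L l u', forall j, (v j <= u j <= v j + (j \in J))%N &
    forall j, (v j <= u' j <= v j + (j \in J))%N].
Proof.
elim: ls J v => //= l' ls IH J v.
pose G j := (L l' (bump v j) + L l' v) * paths (J :\ j) ls (bump v j).
move=> Hs lls.
have [j jJ Gj] : exists2 j, j \in J & G j != 0.
  apply/exists_inP; apply: contraR Hs; rewrite negb_exists_in => /forall_inP Z.
  by rewrite big1 // => c cJ; apply/eqP; have := Z c cJ; rewrite negbK.
have bd i : (v i <= bump v j i <= v i + (i \in J))%N.
  by rewrite ffunE leq_addr leq_add2l; case: eqP => // ->; rewrite jJ.
move: Gj; rewrite /G mulf_eq0 negb_or => /andP[d p].
rewrite inE in lls; case/orP: lls => [/eqP ->|lls].
  exists (bump v j), v; split=> // [|i]; last by rewrite leqnn leq_addr.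
  by apply: contra d => /eqP ->; rewrite F2_addxx.
have [u [u' [uu ub u'b]]] := IH _ _ p lls.
have E w : (forall i, bump v j i <= w i <= bump v j i + (i \in J :\ j))%N ->
   forall i, (v i <= w i <= v i + (i \in J))%N.
  move=> H i; have := H i; rewrite !inE ffunE; case: eqP => [->|_] /=.
    by rewrite addn0 jJ => /andP[/(leq_trans (leq_addr _ _)) -> ->].
  by rewrite addn0.
by exists u, u'; split=> //; apply: E.
Qed.

End Kuhn.

(** In some unit cell of the grid each label takes both values: otherwise the cup
    product would vanish on every cell. *)
Lemma kuhn_cube n k (L : 'I_n -> {ffun 'I_n -> nat} -> bool) :
  (forall j (w : {ffun _ -> _}), w j = 0%N -> L j w = false) ->
  (forall j (w : {ffun _ -> _}), w j = k -> L j w) ->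
  exists v : {ffun 'I_n -> nat}, (forall j, (v j < k)%N) /\ forall i, exists u u' : {ffun _ -> _},
   [/\ L i u = false, L i u', forall j, (v j <= u j <= (v j).+1)%N &
    forall j, (v j <= u' j <= (v j).+1)%N].
Proof.
move=> L0 L1.
pose L' j w : 'F_2 := if L j w then 1 else 0.
have := @kuhn_sum n L' k (enum 'I_n) [ffun=> 0%N] (enum_uniq _).
have -> : [set j in enum 'I_n] = [set: 'I_n]%SET by apply/setP => j; rewrite !inE mem_enum.
move=> H.
have {}H : box k (enum 'I_n) (paths L' [set: 'I_n]%SET (enum 'I_n)) [ffun=> 0%N] != 0.
  rewrite H // => j w wj; rewrite /L'; first by rewrite L0.
  by rewrite L1.
have [v [pv vk _]] := box_neq0 H; exists v; split=> [j|i].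
  by apply: vk; rewrite mem_enum.
have Lin : i \in enum 'I_n by rewrite mem_enum.
have [u [u' [uu' ub u'b]]] := paths_neq0 pv Lin.
have {}ub j : (v j <= u j <= (v j).+1)%N by rewrite -addn1; have := ub j; rewrite finset.in_setT.
have {}u'b j : (v j <= u' j <= (v j).+1)%N by rewrite -addn1; have := u'b j; rewrite finset.in_setT.
move: uu'; rewrite /L'; case E: (L i u); case E': (L i u'); rewrite ?eqxx // => _.
  by exists u', u.
by exists u, u'.
Qed.

(** * The Hahn-Banach theorem *)

Section Functionals.
Context {R : realType} {V : lmodType R}.
Implicit Types (u w : V -> R) (x y : V).

Lemma scalarD u : scalar u -> forall x y, u (x + y) = u x + u y.
Proof. by move=> hu x y; have := hu 1 x y; rewrite scale1r mul1r. Qed.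

Lemma scalar0 u : scalar u -> u 0 = 0.
Proof. by move=> hu; have := scalarD _ hu 0 0; rewrite addr0; lra. Qed.

Lemma scalarZ u : scalar u -> forall a x, u (a *: x) = a * u x.
Proof. by move=> hu a x; have := hu a x 0; rewrite addr0 (scalar0 _ hu) addr0. Qed.

Lemma scalarN u : scalar u -> forall x, u (- x) = - u x.
Proof. by move=> hu x; rewrite -scaleN1r scalarZ // mulN1r. Qed.

Lemma scalarB u : scalar u -> forall x y, u (x - y) = u x - u y.
Proof. by move=> hu x y; rewrite scalarD // scalarN. Qed.

Lemma scalar_sum u : scalar u -> forall (I : Type) (r : seq I) (P : pred I) (F : I -> V),
  u (\sum_(i <- r | P i) F i) = \sum_(i <- r | P i) u (F i).
Proof.
move=> hu I r P F; elim/big_rec2: _; first exact: scalar0.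
by move=> i a b _ <-; rewrite scalarD.
Qed.

Lemma scalar_comb u w a : scalar u -> scalar w -> scalar (fun x => u x + a * w x).
Proof. by move=> hu hw b x y; rewrite hu hw; ring. Qed.

Lemma scalar_sumf (n : nat) (a : 'I_n -> R) (F : 'I_n -> V -> R) :
  (forall i, scalar (F i)) -> scalar (fun x => \sum_i a i * F i x).
Proof.
move=> hF b x y; rewrite mulr_sumr -big_split /=; apply: eq_bigr => i _.
by rewrite hF; ring.
Qed.

Definition sublinear (q : V -> R) : Prop :=
  (forall x y, q (x + y) <= q x + q y) /\
  (forall a x, 0 <= a -> q (a *: x) = a * q x).

Lemma sublinear0 q : sublinear q -> q 0 = 0.
Proof. by case=> _ h; have := h 0 0 (lexx _); rewrite scale0r mul0r. Qed.

(** The largest sublinear function below [q] whose value at [- x] is [- q x]. *)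
Definition reduct (q : V -> R) x y : R :=
  inf [set q (y + t *: x) - t * q x | t in [set t | 0 <= t]].

Lemma reduct_lb q x y t : sublinear q -> 0 <= t -> - q (- y) <= q (y + t *: x) - t * q x.
Proof.
move=> [qD qZ] t0; have := qD (y + t *: x) (- y); rewrite addrAC subrr add0r qZ //; lra.
Qed.

Lemma reduct_le q x y t : sublinear q -> 0 <= t -> reduct q x y <= q (y + t *: x) - t * q x.
Proof.
move=> sq t0; apply: ge_inf; last by exists t.
by exists (- q (- y)) => _ [r r0 <-]; exact: reduct_lb.
Qed.

Lemma le_reduct q x y c :
  (forall t, 0 <= t -> c <= q (y + t *: x) - t * q x) -> c <= reduct q x y.
Proof.
move=> h; apply: lb_le_inf; first by exists (q (y + 0 *: x) - 0 * q x); exists 0 => //=.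
by move=> _ [t t0 <-]; exact: h.
Qed.

Lemma reduct_sublinear q x : sublinear q -> sublinear (reduct q x).
Proof.
move=> sq; have [qD qZ] := sq.
have sub y z : reduct q x (y + z) <= reduct q x y + reduct q x z.
  rewrite -lerBlDr; apply: le_reduct => t t0.
  rewrite lerBlDl -lerBlDr; apply: le_reduct => r r0.
  have := reduct_le q x (y + z) (t + r) sq (addr_ge0 t0 r0).
  have := qD (y + t *: x) (z + r *: x).
  rewrite addrACA -scalerDl; lra.
split=> // a y; rewrite le_eqVlt => /orP[/eqP <-|a0].
  rewrite scale0r mul0r; apply/eqP; rewrite eq_le; apply/andP; split.
    by have := reduct_le q x 0 0 sq (lexx _); rewrite scale0r addr0 mul0r subr0 (sublinear0 _ sq).
  by apply: le_reduct => t t0; rewrite add0r qZ // subrr.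
apply/eqP; rewrite eq_le; apply/andP; split.
  rewrite -ler_pdivrMl //; apply: le_reduct => t t0.
  rewrite ler_pdivrMl //.
  have := reduct_le q x (a *: y) (a * t) sq (mulr_ge0 (ltW a0) t0).
  rewrite -scalerA -scalerDr qZ ?(ltW a0) //; lra.
apply: le_reduct => t t0; rewrite -ler_pdivlMl //.
have ai : 0 <= a^-1 by rewrite invr_ge0 ltW.
have := reduct_le q x y (a^-1 * t) sq (mulr_ge0 ai t0).
have -> : y + (a^-1 * t) *: x = a^-1 *: (a *: y + t *: x).
  by rewrite scalerDr scalerA mulVf ?gt_eqF // scale1r scalerA.
by rewrite qZ // mulrBr mulrA.
Qed.

(** Zorn's lemma: a chain of sublinear functions is bounded below by
    [fun x => - q (- x)] for any member [q], so that its infimum is finite, and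
    this infimum is sublinear. *)
Lemma minimal_sublinear (p : V -> R) : sublinear p ->
  exists q : V -> R, [/\ sublinear q, forall x, q x <= p x &
    forall r, sublinear r -> (forall x, r x <= q x) -> r = q].
Proof.
move=> sp; pose P (q : V -> R) := sublinear q /\ forall x, q x <= p x.
pose T := {q : V -> R | P q}.
pose le (s t : T) := `[< forall x, sval t x <= sval s x >].
have [||||t tm] := @Zorn T le.
- by move=> t; apply/asboolP.
- by move=> r s t /asboolP rs /asboolP st; apply/asboolP => x; exact: le_trans (st x) (rs x).
- move=> [s Ps] [t Pt] /asboolP st /asboolP ts; apply: eq_exist; apply/funext => x.
  by apply/eqP; rewrite eq_le st ts.
- move=> A totA.
  have [[s0 As0]|A0] := pselect (exists s, A s); last first.
    have Pp : P p by split.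
    by exists (exist P p Pp) => s As; exfalso; apply: A0; exists s.
  pose S x := [set sval s x | s in A].
  have Slb s x : A s -> - sval s0 (- x) <= sval s x.
    move=> As; case: (totA _ _ As As0) => /asboolP h.
      have [[qD _] _] := svalP s0; have := qD x (- x).
      by rewrite subrr sublinear0; last exact: (svalP s0).1; have := h x; lra.
    have [[qD _] _] := svalP s; have := qD x (- x).
    by rewrite subrr sublinear0; last exact: (svalP s).1; have := h (- x); lra.
  have infub s x : A s -> inf (S x) <= sval s x.
    move=> As; apply: ge_inf; last by exists s.
    by exists (- sval s0 (- x)) => _ [r Ar <-]; exact: Slb.
  have lbinf c x : (forall s, A s -> c <= sval s x) -> c <= inf (S x).
    move=> h; apply: lb_le_inf; first by exists (sval s0 x); exists s0.
    by move=> _ [s As <-]; exact: h.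
  have Pq : P (fun x => inf (S x)).
    split; last by move=> x; apply: le_trans (infub s0 x As0) _; exact: (svalP s0).2.
    split=> [x y|a x a0].
      rewrite -lerBlDr; apply: (lbinf) => s As.
      rewrite lerBlDl -lerBlDr; apply: (lbinf) => r Ar; rewrite lerBlDr.
      case: (totA _ _ As Ar) => /asboolP h.
        apply: le_trans (infub r _ Ar) _; have [[qD _] _] := svalP r.
        by have := qD x y; have := h x; lra.
      apply: le_trans (infub s _ As) _; have [[qD _] _] := svalP s.
      by have := qD x y; have := h y; lra.
    apply/eqP; rewrite eq_le; apply/andP; split; last first.
      apply: (lbinf) => s As; have [[_ qZ] _] := svalP s; rewrite qZ //.
      by apply: ler_wpM2l => //; exact: infub.
    rewrite le_eqVlt in a0; case/orP: a0 => [/eqP <-|a0].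
      rewrite mul0r; apply: le_trans (infub s0 _ As0) _.
      by rewrite scale0r sublinear0 //; exact: (svalP s0).1.
    rewrite -ler_pdivrMl //; apply: (lbinf) => s As; rewrite ler_pdivrMl //.
    by have [[_ qZ] _] := svalP s; rewrite -qZ ?(ltW a0) //; exact: infub.
  by exists (exist P _ Pq) => s As; apply/asboolP => x; exact: infub.
exists (sval t); have [st tp] := svalP t; split=> // r sr rt.
have Pr : P r by split=> // x; exact: le_trans (rt x) (tp x).
have rt' : le t (exist P r Pr) by apply/asboolP.
by rewrite -(tm _ rt').
Qed.

(** A minimal sublinear function equals each of its reducts, hence is odd, hence
    linear. Starting below the reduct of [N] along [x], the linear function
    obtained takes at [- x] a value at most [- N x]. *)
Theorem hahn_banach_norming (N : V -> R) x : is_norm N ->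
  exists u, [/\ scalar u, forall y, `|u y| <= N y & u x = N x].
Proof.
move=> [N0 _ ND NZ].
have sN : sublinear N by split=> // a y a0; rewrite NZ ger0_norm.
have [q [sq qp qmin]] := minimal_sublinear _ (reduct_sublinear _ x sN).
have redle p z y : sublinear p -> reduct p z y <= p y.
  by move=> sp; have := reduct_le p z y 0 sp (lexx _); rewrite scale0r addr0 mul0r subr0.
have qN y : q (- y) = - q y.
  have E : reduct q y = q by apply: qmin; [exact: reduct_sublinear | move=> z; exact: redle].
  apply/eqP; rewrite eq_le; apply/andP; split.
    have := reduct_le q y (- y) 1 sq ler01; rewrite E scale1r addNr mul1r sublinear0 //; lra.
  by have := sq.1 y (- y); rewrite subrr sublinear0 //; lra.
have qD y z : q (y + z) = q y + q z.
  apply/eqP; rewrite eq_le sq.1 /=.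
  by have := sq.1 (- y) (- z); rewrite -opprD !qN; lra.
have qZ a y : q (a *: y) = a * q y.
  have [a0|a0] := leP 0 a; first exact: sq.2.
  have := sq.2 (- a) y; rewrite scaleNr qN oppr_ge0 ltW // => /(_ isT); lra.
have qle y : q y <= N y by apply: le_trans (qp y) (redle _ _ _ sN).
have NN y : N (- y) = N y by rewrite -scaleN1r NZ normrN normr1 mul1r.
exists q; split.
- by move=> a y z; rewrite qD qZ.
- by move=> y; rewrite ler_norml qle andbT; have := qle (- y); rewrite qN NN; lra.
- apply/eqP; rewrite eq_le qle /=.
  have := qp (- x); have := reduct_le N x (- x) 1 sN ler01.
  by rewrite scale1r addNr qN mul1r sublinear0 //; lra.
Qed.

End Functionals.

(** * Dual norms and subspaces of finite codimension *)

Section DualNorm.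
Context {R : realType} {V : lmodType R}.
Variable N : V -> R.
Hypothesis hN : is_norm N.
Implicit Types (u w : V -> R) (x y z : V).

Lemma norm0 : N 0 = 0.
Proof. by have [_ _ _ NZ] := hN; have := NZ 0 0; rewrite scale0r normr0 mul0r. Qed.

Lemma normN x : N (- x) = N x.
Proof. by have [_ _ _ NZ] := hN; rewrite -scaleN1r NZ normrN normr1 mul1r. Qed.

(** The real number that [dual_norm N u] is for [u] in the dual. *)
Definition nrm u : R := sup [set `|u x| | x in [set x | N x <= 1]].

Lemma nrm_has_sup u : dual N u -> has_sup [set `|u x| | x in [set x | N x <= 1]].
Proof.
move=> [hu [C uC]]; split; first by exists `|u 0|, 0 => //=; rewrite norm0.
have [N0 _ _ _] := hN; exists `|C| => _ [x /= Nx <-].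
apply: le_trans (uC x) _; apply: le_trans (ler_norm _) _.
by rewrite normrM (ger0_norm (N0 x)) ler_piMr.
Qed.

Lemma nrm_ub u x : dual N u -> `|u x| <= nrm u * N x.
Proof.
move=> du; have [hu _] := du; have [N0 Nz ND NZ] := hN.
have [x0|x0] := eqVneq (N x) 0; first by rewrite (Nz _ x0) (scalar0 _ hu) norm0 normr0 mulr0.
have xp : 0 < N x by rewrite lt_neqAle eq_sym x0 N0.
rewrite -ler_pdivrMr //.
have -> : `|u x| / N x = `|u ((N x)^-1 *: x)|.
  by rewrite (scalarZ _ hu) normrM ger0_norm ?invr_ge0 ?N0 // mulrC.
apply: ub_le_sup; first exact: (nrm_has_sup _ du).2.
by exists ((N x)^-1 *: x) => //=; rewrite NZ ger0_norm ?invr_ge0 // mulVf.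
Qed.

Lemma nrm_le u c : 0 <= c -> (forall x, `|u x| <= c * N x) -> nrm u <= c.
Proof.
move=> c0 uc; apply: ge_sup; first by exists `|u 0|, 0 => //=; rewrite norm0.
by move=> _ [x /= Nx <-]; apply: le_trans (uc x) _; rewrite ler_piMr.
Qed.

Lemma nrm_ge0 u : dual N u -> 0 <= nrm u.
Proof.
move=> du; apply: le_trans (normr_ge0 (u 0)) _.
apply: ub_le_sup; first exact: (nrm_has_sup _ du).2.
by exists 0 => //=; rewrite norm0.
Qed.

Lemma nrm_adherent u e : dual N u -> 0 < e -> exists2 x, N x <= 1 & nrm u - e < u x.
Proof.
move=> du e0; have [_ [x /= Nx <-]] := sup_adherent e0 (nrm_has_sup _ du).
have [hu _] := du.
have [u0|u0] := leP 0 (u x); first by rewrite ger0_norm //; exists x.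
by rewrite ltr0_norm // -(scalarN _ hu); exists (- x) => //; rewrite normN.
Qed.

Lemma dual_normE u : dual N u -> dual_norm N u = (nrm u)%:E.
Proof.
move=> du; rewrite /dual_norm /nrm -ereal_sup_EFin; last 2 first.
- exact: (nrm_has_sup _ du).2.
- exact: (nrm_has_sup _ du).1.
by rewrite image_comp.
Qed.

Lemma dual_comb u w a : dual N u -> dual N w -> dual N (fun x => u x + a * w x).
Proof.
move=> [hu [C uC]] [hw [D wD]]; split; first exact: scalar_comb.
exists (C + `|a| * D) => x; apply: le_trans (ler_normD _ _) _.
by rewrite mulrDl lerD // normrM -mulrA ler_wpM2l.
Qed.

Lemma dual0 : dual N (fun=> 0).
Proof.
by split; [move=> a x y; rewrite mulr0 addr0|exists 0 => x; rewrite normr0 mul0r].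
Qed.

Lemma dualZ u a : dual N u -> dual N (fun x => a * u x).
Proof.
move=> du; have := dual_comb _ _ a dual0 du.
by congr (dual N _); apply/funext => x; rewrite add0r.
Qed.

Lemma dual_sum n (a : 'I_n -> R) (F : 'I_n -> V -> R) :
  (forall i, dual N (F i)) -> dual N (fun x => \sum_i a i * F i x).
Proof.
move=> dF; split; first by apply: scalar_sumf => i; exact: (dF i).1.
exists (\sum_i `|a i| * nrm (F i)) => x.
apply: le_trans (ler_norm_sum _ _ _) _; rewrite mulr_suml; apply: ler_sum => i _.
by rewrite normrM -mulrA; apply: ler_wpM2l => //; exact: nrm_ub.
Qed.

Lemma nrm_comb u w a : dual N u -> dual N w ->
  nrm (fun x => u x + a * w x) <= nrm u + `|a| * nrm w.
Proof.
move=> du dw; apply: nrm_le => [|x].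
  by apply: addr_ge0; [exact: nrm_ge0|apply: mulr_ge0 => //; exact: nrm_ge0].
apply: le_trans (ler_normD _ _) _; rewrite mulrDl lerD ?nrm_ub //.
by rewrite normrM -mulrA ler_wpM2l // nrm_ub.
Qed.

Lemma nrmZ u a : dual N u -> nrm (fun x => a * u x) = `|a| * nrm u.
Proof.
move=> du; apply/eqP; rewrite eq_le; apply/andP; split.
  have := nrm_comb _ _ a dual0 du.
  have -> : nrm (fun=> 0) = 0.
    apply/eqP; rewrite eq_le nrm_ge0 ?andbT; last exact: dual0.
    by apply: nrm_le => // x; rewrite normr0 mul0r.
  by rewrite add0r; congr (nrm _ <= _); apply/funext => x; rewrite add0r.
have [->|a0] := eqVneq a 0.
  by rewrite normr0 mul0r nrm_ge0 //; exact: dualZ.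
rewrite -ler_pdivlMl ?normr_gt0 //; apply: nrm_le.
  by apply: mulr_ge0; [rewrite invr_ge0|apply: nrm_ge0; exact: dualZ].
move=> x; rewrite -mulrA ler_pdivlMl ?normr_gt0 // -normrM.
exact: (nrm_ub (fun x => a * u x) x (dualZ _ _ du)).
Qed.

Lemma dual_sphereE u : dual_sphere N u <-> dual N u /\ nrm u = 1.
Proof.
split=> [[du]|[du u1]]; first by rewrite /= dual_normE // => -[].
by split => //=; rewrite dual_normE // u1.
Qed.

Lemma norming x : exists u, [/\ dual N u, nrm u <= 1 & u x = N x].
Proof.
have [u [hu ub ux]] := hahn_banach_norming N x hN.
have ub1 y : `|u y| <= 1 * N y by rewrite mul1r.
by exists u; split=> //; [split=> //; exists 1 | exact: nrm_le].
Qed.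

(** A bounded projection onto [E], built one generator at a time: a functional
    which does not vanish on the new generator is corrected so as to vanish on
    the previous ones. *)
Lemma fin_dim_projection E : fin_dim_subspace E ->
  exists n (e : 'I_n -> V) (psi : 'I_n -> V -> R),
    (forall i, dual N (psi i)) /\ forall x, E x -> x = \sum_i psi i x *: e i.
Proof.
move=> [n [g ->]]; elim: n g => [|n IH] g.
  exists 0%N, g, (fun _ _ => 0); split=> [[]//|_ [a _ <-]].
  by rewrite !big_ord0.
have [m [e [psi [dpsi P]]]] := IH (fun i => g (lift ord0 i)).
pose E' : set V := range (fun a : 'I_n -> R => \sum_i a i *: g (lift ord0 i)).
have {}P : forall x, E' x -> x = \sum_i psi i x *: e i := P.
have E'P x : range (fun a : 'I_n.+1 -> R => \sum_i a i *: g i) x ->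
    exists a y, E' y /\ x = a *: g ord0 + y.
  move=> [a _ <-]; exists (a ord0), (\sum_i a (lift ord0 i) *: g (lift ord0 i)).
  by split; [exists (fun i => a (lift ord0 i)) | rewrite big_ord_recl].
have scp i := (dpsi i).1.
set r := g ord0 - \sum_i psi i (g ord0) *: e i.
have [r0|r0] := eqVneq r 0.
  exists m, e, psi; split=> // x /E'P[a [y [Ey ->]]].
  under eq_bigr do rewrite (scalarD _ (scp _)) (scalarZ _ (scp _)) scalerDl -scalerA.
  rewrite big_split /= -scaler_sumr -(P y Ey); congr (_ *: _ + _).
  by apply/eqP; rewrite -subr_eq0 -/r r0.
have [u [du _ ur]] := norming r; have [hu _] := du.
have ur0 : u r != 0.
  by rewrite ur; apply: contra r0 => /eqP Nr; have [_ /(_ _ Nr) -> _ _] := hN.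
pose v x := u x + (-1) * \sum_i u (e i) * psi i x.
have dv : dual N v by apply: dual_comb => //; exact: dual_sum.
have hv := dv.1.
have vE y : E' y -> v y = 0.
  move=> Ey; rewrite /v {1}(P _ Ey) (scalar_sum _ hu) mulN1r.
  apply/eqP; rewrite subr_eq0; apply/eqP; apply: eq_bigr => i _.
  by rewrite (scalarZ _ hu) mulrC.
have vg : v (g ord0) = u r.
  rewrite /v /r (scalarB _ hu) (scalar_sum _ hu) mulN1r; congr (_ - _).
  by apply: eq_bigr => i _; rewrite (scalarZ _ hu) mulrC.
pose c x := (u r)^-1 * v x.
have dc : dual N c by exact: dualZ.
exists m.+1, (fun i => oapp e (g ord0) (unlift ord0 i)),
  (fun i => oapp (fun j x => psi j x + - psi j (g ord0) * c x) c (unlift ord0 i)); split.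
  by move=> i; case: unliftP => [j _|_] //=; exact: dual_comb.
move=> x /E'P[a [y [Ey ->]]]; rewrite big_ord_recl unlift_none /=.
have cE : c (a *: g ord0 + y) = a.
  by rewrite /c (scalarD _ hv) (vE _ Ey) addr0 (scalarZ _ hv) vg mulrC mulfK.
rewrite cE; congr (_ + _); rewrite {1}(P _ Ey); apply: eq_bigr => i _.
by rewrite liftK /= cE (scalarD _ (scp i)) (scalarZ _ (scp i)); congr (_ *: _); ring.
Qed.

(** The subspace of finite codimension inside [S] is presented by functionals,
    which serve as coordinates on the quotient in [gorelik]. *)
Definition fin_codim (S : set V) : Prop :=
  exists n (phi : 'I_n -> V -> R), (forall i, dual N (phi i)) /\
    forall z, (forall i, phi i z = 0) -> S z.

Lemma fin_codimS (S T : set V) : S `<=` T -> fin_codim S -> fin_codim T.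
Proof. by move=> ST [n [phi [dphi P]]]; exists n, phi; split=> // z /P /ST. Qed.

Lemma fin_codimI (S T : set V) : fin_codim S -> fin_codim T -> fin_codim (S `&` T).
Proof.
move=> [n [phi [dphi P]]] [m [psi [dpsi Q]]].
exists (n + m)%N, (fun i : 'I_(n + m) =>
  match fintype.split i with inl j => phi j | inr j => psi j end).
split=> [i|z h]; first by case: fintype.split.
split; [apply: P => i; have := h (lshift m i) | apply: Q => i; have := h (rshift n i)].
- by rewrite -[lshift m i]/(unsplit (inl i)) unsplitK.
- by rewrite -[rshift n i]/(unsplit (inr i)) unsplitK.
Qed.

Lemma fin_codimT : fin_codim setT.
Proof. by exists 0%N, (fun _ _ => 0); split=> // -[]. Qed.

(** A family with the smallest number of functionals is independent: a relation
    would allow one of them to be dropped. *)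
Lemma fin_codim_independent (S : set V) : fin_codim S ->
  exists n (phi : 'I_n -> V -> R), [/\ forall i, dual N (phi i),
    forall z, (forall i, phi i z = 0) -> S z &
    forall c : 'I_n -> R, (forall z, \sum_i c i * phi i z = 0) -> forall i, c i = 0].
Proof.
move=> [n]; elim: n => [|n IH] [phi [dphi P]].
  by exists 0%N, phi; split=> // c _ [].
have [[c [cz [j cj]]]|H] := pselect (exists c : 'I_n.+1 -> R,
    (forall z, \sum_i c i * phi i z = 0) /\ exists i, c i <> 0); last first.
  exists n.+1, phi; split=> // c cz i; apply: contrapT => ci.
  by apply: H; exists c; split=> //; exists i.
apply: IH; exists (fun i => phi (lift j i)); split=> // z h.
apply: P => i; case: (unliftP j i) => [k ->|->]; first exact: h.
have := cz z; rewrite (bigD1 j) //= big1 ?addr0; last first.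
  by move=> k; rewrite eq_sym => /unlift_some[l -> _]; rewrite h mulr0.
by move/eqP; rewrite mulf_eq0 => /orP[/eqP //|/eqP].
Qed.

End DualNorm.

Lemma normr_is_norm (R : realType) (V : normedModType R) : is_norm (fun x : V => `|x|).
Proof.
split=> // [x /normr0_eq0 //|x y|a x]; first exact: ler_normD.
by rewrite normrZ.
Qed.

(** * A variational inequality on the cube *)

Lemma compact_finite_pick (T : topologicalType) (A : set T) (U : T -> set T) :
  compact A -> (forall x, A x -> nbhs x (U x)) ->
  exists n (p : 'I_n -> T), (forall i, A (p i)) /\
    forall y, A y -> exists i, U (p i) y.
Proof.
move=> /compact_near_coveringP cA AU.
pose above (s0 : seq T) := [set s : seq T | {subset s0 <= s}].
pose F : set_system (seq T) := filter_from setT above.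
have FF : Filter F.
  apply: filter_from_filter; first by exists [::].
  move=> s t _ _; exists (s ++ t) => // r sub.
  by split=> x xs; apply: sub; rewrite mem_cat xs ?orbT.
pose P (s : seq T) y := exists x, [/\ x \in s, A x & U x y].
have [|s0 _ Fs] := cA _ F P FF.
  move=> x Ax; exists (U x, above [:: x]); first by split; [exact: AU|exists [:: x]].
  move=> [y s] /= [Uy xs]; exists x; split=> //.
  by apply: xs; rewrite inE.
have {}Fs : A `<=` P s0 by apply: Fs.
pose s := [seq x <- s0 | `[< A x >]].
exists (size s), (tnth (in_tuple s)); split=> [i|y /Fs[x [xs Ax Uxy]]].
  by have := mem_tnth i (in_tuple s); rewrite mem_filter => /andP[/asboolP].
have /tnthP[i xi] : x \in in_tuple s by rewrite mem_filter xs andbT; apply/asboolP.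
by exists i; rewrite -xi.
Qed.

Definition cube {R : realType} n : set 'rV[R]_n := [set c | forall i, 0 <= c 0 i <= 1].

Lemma cube_compact (R : realType) n : compact (@cube R n).
Proof.
rewrite /cube; apply: (@rV_compact _ n (fun=> [set x : R | 0 <= x <= 1])) => i.
have -> : [set x : R | 0 <= x <= 1] = `[0, 1]%classic.
  by apply/seteqP; split => x /=; rewrite in_itv.
exact: segment_compact.
Qed.

(** Label a point of a fine grid by the signs of [s i], corrected on the faces of
    the cube; a limit of cells on which all the labels take both values is a
    solution. *)
Lemma cube_complementarity (R : realType) n (s : 'I_n -> 'rV[R]_n -> R) :
  (forall i, continuous (s i)) ->
  exists c, cube n c /\
    forall i, (c 0 i = 0 \/ s i c <= 0) /\ (c 0 i = 1 \/ 0 <= s i c).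
Proof.
move=> sc.
pose pt (k : nat) (w : {ffun 'I_n -> nat}) : 'rV[R]_n := \row_j ((w j)%:R / k.+1%:R).
pose L k i (w : {ffun 'I_n -> nat}) :=
  (w i != 0%N) && ((w i == k.+1) || (0 < s i (pt k w))).
have /choice[v vP] : forall k : nat, exists v : {ffun 'I_n -> nat},
  (forall j, (v j < k.+1)%N) /\ forall i, exists u u' : {ffun _ -> _},
   [/\ L k i u = false, L k i u', forall j, (v j <= u j <= (v j).+1)%N &
    forall j, (v j <= u' j <= (v j).+1)%N].
  move=> k; apply: kuhn_cube => j w wj; rewrite /L wj ?eqxx //.
have kp (k : nat) : 0 < k.+1%:R :> R by rewrite ltr0n.
have ptc k (w : {ffun _ -> _}) : (forall j, (w j <= k.+1)%N) -> cube n (pt k w).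
  move=> wk j; rewrite mxE; apply/andP; split; first by rewrite divr_ge0 // ltW.
  by rewrite ler_pdivrMr // mul1r ler_nat.
have [|c [cc cl]] := @cube_compact R n ((fun k => pt k (v k)) @ \oo) _.
  by exists 0%N => // k _ /=; apply: ptc => j; apply: ltnW; exact: (vP k).1.
exists c; split=> //.
(* Near [c] there are whole cells of arbitrarily fine grids. *)
have key (P : 'rV[R]_n -> Prop) : (\forall x \near c, P x) ->
    exists k, forall w : {ffun 'I_n -> nat},
      (forall j, (v k j <= w j <= (v k j).+1)%N) -> P (pt k w).
  move=> /nbhs_ballP[e /= e0 eP].
  have e20 : 0 < e / 2 by lra.
  have [K KP] : exists K : nat, forall k : nat, (K <= k)%N -> k.+1%:R^-1 < e / 2 :> R.
    have : \forall k \near \oo, (k.+1%:R^-1 : R) < e / 2.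
      have /cvgrPdist_lt /(_ _ e20) := @cvg_harmonic R.
      by apply: filterS => k; rewrite sub0r normrN ger0_norm // invr_ge0 ltW.
    by move=> [K _ KP]; exists K => k /KP.
  have := cl [set x | exists2 k, (K <= k)%N & x = pt k (v k)] (ball c (e / 2)).
  case=> [||x [[k Kk ->] xc]].
  - by exists K => // k /= Kk; exists k.
  - exact: nbhsx_ballx.
  exists k => w wv; apply: eP; rewrite (splitr e); apply: ball_triangle xc _.
  split=> // i j; rewrite /ball /= !mxE -mulrBl normrM [`|_^-1|]ger0_norm ?invr_ge0 ?ltW //.
  apply: (le_lt_trans _ (KP k Kk)); rewrite ler_piMl ?invr_ge0 ?ler0n //.
  have /andP[h1 h2] := wv j.
  by rewrite distrC -natrB // ger0_norm // lern1 leq_subLR addn1.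
have ci := @coord_continuous R 1 n 0.
move=> i; have /andP[ci0 ci1] := cc i; split.
- have [cE|cN0] := eqVneq (c 0 i) 0; [by left|right].
  rewrite leNgt; apply/negP => si.
  have cip : 0 < c 0 i by rewrite lt_neqAle eq_sym cN0.
  have [|k kP] := key (fun x => 0 < x 0 i /\ 0 < s i x).
    apply: filterI; first exact: (cvgr_gt _ (ci i c)).
    exact: (cvgr_gt _ (sc i c)).
  have [u [_ [Lu _ uv _]]] := (vP k).2 i.
  have [u0 su] := kP u uv; move: Lu; rewrite /L su orbT andbT.
  move/negbFE/eqP => ui; move: u0; rewrite mxE ui mul0r ltxx //.
- have [cE|cN1] := eqVneq (c 0 i) 1; [by left|right].
  rewrite leNgt; apply/negP => si.
  have cip : c 0 i < 1 by rewrite lt_neqAle cN1.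
  have [|k kP] := key (fun x => x 0 i < 1 /\ s i x < 0).
    apply: filterI; first exact: (cvgr_lt _ (ci i c)).
    exact: (cvgr_lt _ (sc i c)).
  have [_ [u [_ Lu _ uv]]] := (vP k).2 i.
  have [u1 su] := kP u uv; move: Lu; rewrite /L ltNge (ltW su) orbF => /andP[_ /eqP uk].
  by move: u1; rewrite mxE uk divff ?ltxx // gt_eqF.
Qed.

(** * Weak-star compactness and the asymptotic shape of the norm *)

Section RealContinuity.
Context {R : realType} {T : topologicalType}.
Implicit Types f g h : T -> R.

Lemma continuous_comb f g h a : continuous f -> continuous g -> continuous h ->
  continuous (fun t => f t - (a * g t + h t)).
Proof.
move=> fc gc hc t; apply: cvgB; first exact: fc.
apply: cvgD; last exact: hc.
by apply: cvgM; [exact: cvg_cst | exact: gc].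
Qed.

Lemma continuous_abs f : continuous f -> continuous (fun t => `|f t|).
Proof. by move=> fc t; apply: cvg_norm; exact: fc. Qed.

Lemma cvg_dist0 f (t0 : T) : continuous f -> (fun t => `|f t - f t0|) @ t0 --> (0 : R).
Proof.
move=> fc; have -> : (0 : R) = `|f t0 - f t0| by rewrite subrr normr0.
by apply: cvg_norm; apply: cvgB; [exact: fc | exact: cvg_cst].
Qed.

Lemma cvg_sum0 n (f : 'I_n -> T -> R) (c : 'I_n -> R) (t0 : T) :
  (forall i, f i t @[t --> t0] --> (0 : R)) -> \sum_i f i t * c i @[t --> t0] --> (0 : R).
Proof.
move=> f0; have E : \sum_(i < n) 0 * c i = 0.
  by rewrite big1 // => i _; rewrite mul0r.
rewrite -[X in _ --> X]E; apply: (@cvg_big R 'I_n +%R 0 xpredT (@add_continuous R) T (nbhs t0)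
  (index_enum _) (fun i t => f i t * c i) (fun i => 0 * c i)) => i _.
by apply: cvgM; [exact: f0 | exact: cvg_cst].
Qed.

End RealContinuity.

Section Asymptotic.
Context {R : realType} {V : lmodType R}.
Variable N : V -> R.
Hypothesis hN : is_norm N.
Implicit Types (u w z : V -> R).

Lemma alaoglu :
  compact ([set u | scalar u /\ forall x, `|u x| <= N x] : set {ptws V -> R}).
Proof.
have cB : compact ([set u | forall x, `[- N x, N x]%classic (u x)] : set {ptws V -> R}).
  by apply: (@tychonoff V (fun=> R) (fun x => `[- N x, N x]%classic)) => x; exact: segment_compact.
apply: subclosed_compact cB _; last first.
  by move=> u [_ uN] x /=; rewrite in_itv /= -ler_norml.
have evc (x : V) : continuous (fun u : {ptws V -> R} => u x).
  exact: (@proj_continuous V (fun=> R) x).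
have -> : [set u : {ptws V -> R} | scalar u /\ forall x, `|u x| <= N x] =
  (\bigcap_(t in [set: R * V * V])
     (fun u : {ptws V -> R} => u (t.1.1 *: t.1.2 + t.2) - (t.1.1 * u t.1.2 + u t.2)) @^-1` [set 0]) `&`
  \bigcap_(x in [set: V]) (fun u : {ptws V -> R} => `|u x|) @^-1` [set r | r <= N x].
  apply/seteqP; split=> [u [hu uN]|u [hu uN]].
    by split=> [[[a x] y] _|x _] /=; [rewrite hu subrr | exact: uN].
  split=> [a x y|x]; last exact: (uN x).
  by have /eqP := hu (a, x, y) I; rewrite subr_eq0 => /eqP.
apply: closedI; apply: closed_bigI => t _.
  apply: (continuous_closedP _).1 (@closed_eq R 0).
  case: t => [[a x] y] /=.
  exact: (@continuous_comb _ {ptws V -> R} (fun u => u (a *: x + y))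
    (fun u => u x) (fun u => u y) a).
apply: (continuous_closedP _).1 (@closed_le R (N t)).
exact: (@continuous_abs _ {ptws V -> R} (fun u => u t)).
Qed.

Variables s th : R.
Hypotheses (s0 : 0 < s) (ths : th <= s).

(** The consequence of [th' < theta_bar N s] that the proof uses, stated with
    real-valued norms. *)
Definition asym_convex (th' : R) : Prop := forall z, dual N z -> nrm N z = 1 ->
  exists E, fin_dim_subspace E /\ forall w, annihilator N E w -> nrm N w = 1 ->
    1 + th' <= nrm N (fun x => z x + s * w x).

Hypothesis cvx : asym_convex th.

Local Notation sg := (th / s).

Let sg1 : sg <= 1. Proof. by rewrite ler_pdivrMr // mul1r. Qed.

(** The first bound comes from convexity along the segment from [z] to [z + w],
    the second one from the triangle inequality; both rescale the assumption,
    which concerns functionals of norm 1. *)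
Lemma dual_growth z : dual N z ->
  exists E, fin_dim_subspace E /\ forall w b, annihilator N E w ->
    nrm N (fun x => z x + w x) <= b ->
    (s * nrm N z <= nrm N w -> nrm N z + sg * nrm N w <= b) /\
    (nrm N w <= s * nrm N z -> nrm N z * (1 + th - s) + nrm N w <= b).
Proof.
move=> dz; set lam := nrm N z; have lam0 : 0 <= lam by exact: nrm_ge0.
have [lamE|lamN] := eqVneq lam 0.
  have zE x : z x = 0.
    apply/eqP; rewrite -normr_le0; have := nrm_ub N hN z x dz.
    by rewrite -/lam lamE mul0r.
  exists (range (fun a : 'I_0 -> R => \sum_i a i *: (0 : V))); split.
    by exists 0%N, (fun=> 0).
  move=> w b [dw _]; have -> : (fun x => z x + w x) = w by apply/funext => x; rewrite zE add0r.
  have w0 : 0 <= nrm N w by exact: nrm_ge0.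
  rewrite lamE mulr0 mul0r !add0r => wb; split=> [_|//].
  by apply: le_trans wb; rewrite ler_piMl.
have lamp : 0 < lam by rewrite lt_neqAle eq_sym lamN.
pose z' x := lam^-1 * z x.
have dz' : dual N z' by exact: dualZ.
have nz' : nrm N z' = 1.
  by rewrite /z' nrmZ // ger0_norm ?invr_ge0 // mulVf.
have [E [fE EP]] := cvx _ dz' nz'; exists E; split=> // w b [dw wE] zwb.
set tau := nrm N w; have tau0 : 0 <= tau by exact: nrm_ge0.
have dzw : dual N (fun x => z x + w x).
  have := dual_comb N z w 1 dz dw.
  by congr (dual N _); apply/funext => x; rewrite mul1r.
have [tauE|tauN] := eqVneq tau 0.
  have wE0 x : w x = 0.
    apply/eqP; rewrite -normr_le0; have := nrm_ub N hN w x dw.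
    by rewrite -/tau tauE mul0r.
  have lb : lam <= b.
    apply: le_trans zwb; rewrite le_eqVlt; apply/orP; left; apply/eqP.
    by congr (nrm N _); apply/funext => x; rewrite wE0 addr0.
  rewrite tauE mulr0 !addr0; split=> // _; apply: le_trans lb.
  by rewrite ler_piMr // -addrA gerDl subr_le0.
have taup : 0 < tau by rewrite lt_neqAle eq_sym tauN.
pose w' x := tau^-1 * w x.
have dw' : dual N w' by exact: dualZ.
have nw' : nrm N w' = 1.
  by rewrite /w' nrmZ // ger0_norm ?invr_ge0 // mulVf.
have aw' : annihilator N E w'.
  by split=> // x Ex; rewrite /w' wE // mulr0.
have := EP w' aw' nw'.
set r := s * lam / tau => H.
have r0 : 0 < r by rewrite !mulr_gt0 ?invr_gt0.
have {}H : lam * (1 + th) <= nrm N (fun x => z x + r * w x).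
  have E1 : (fun x => z x + r * w x) = (fun x => lam * (z' x + s * w' x)).
    by apply/funext => x; rewrite /r /z' /w'; field; rewrite ?tauN ?lamN.
  rewrite E1 nrmZ ?ger0_norm ?ler_pM2l //; exact: dual_comb.
split=> [le1|le2].
  have r1 : r <= 1 by rewrite /r ler_pdivrMr // mul1r.
  have H2 : nrm N (fun x => z x + r * w x) <= (1 - r) * lam + r * b.
    have E1 : (fun x => z x + r * w x) = (fun x => (1 - r) * z x + r * (z x + w x)).
      by apply/funext => x; ring.
    rewrite E1; apply: le_trans (nrm_comb N hN (fun x => (1 - r) * z x) _ r _ dzw) _;
      first exact: dualZ.
    rewrite nrmZ // !ger0_norm ?subr_ge0 ?(ltW r0) // lerD2l.
    by rewrite ler_pM2l.
  have H3 : r * lam + lam * th <= r * b by lra.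
  rewrite -(ler_pM2l r0) mulrDr; apply: le_trans H3.
  rewrite lerD2l /r le_eqVlt; apply/orP; left; apply/eqP; field.
  by rewrite tauN gt_eqF.
have r1 : 1 <= r by rewrite /r ler_pdivlMr // mul1r.
have H2 : nrm N (fun x => z x + r * w x) <= b + (r - 1) * tau.
  have E1 : (fun x => z x + r * w x) = (fun x => (z x + w x) + (r - 1) * w x).
    by apply/funext => x; ring.
  rewrite E1; apply: le_trans (nrm_comb N hN _ w (r - 1) dzw dw) _.
  by rewrite (ger0_norm (_ : 0 <= r - 1)) ?subr_ge0 // lerD2r.
have E2 : (r - 1) * tau = s * lam - tau by rewrite /r; field; rewrite tauN.
by rewrite E2 in H2; lra.
Qed.

(** A functional [u] of the unit ball that is weak-star close to [z] differs from
    [z] by a functional which nearly vanishes on [E]; correcting it by the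
    projection onto [E] makes [dual_growth] applicable. *)
Lemma dual_growth_near z (dl : R) y : dual N z -> nrm N z <= 1 -> 0 < dl ->
  exists U : set {ptws V -> R}, nbhs (z : {ptws V -> R}) U /\
  forall u, dual N u -> nrm N u <= 1 -> U u -> exists tau,
    [/\ 0 <= tau, s * nrm N z <= tau -> nrm N z + sg * tau <= 1 + dl,
     tau <= s * nrm N z -> nrm N z * (1 + th - s) + tau <= 1 + dl,
     u y <= z y + dl & forall x, u x - z x <= (tau + dl) * N x].
Proof.
move=> dz z1 dl0; have [E [fE EP]] := dual_growth z dz.
have [n [e [psi [dpsi eP]]]] := fin_dim_projection N hN E fE.
pose F (u : V -> R) := \sum_i `|u (e i) - z (e i)| * nrm N (psi i).
exists [set u : {ptws V -> R} | F u < dl /\ `|u y - z y| < dl]; split.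
  have evc (x : V) : (fun u : {ptws V -> R} => `|u x - z x|) @ (z : {ptws V -> R}) --> (0 : R).
    exact: (@cvg_dist0 _ {ptws V -> R} (fun u => u x) z (@proj_continuous V (fun=> R) x)).
  apply: filterI; last exact: (cvgr_lt _ (evc y) _ dl0).
  have Fc := @cvg_sum0 _ {ptws V -> R} n (fun i u => `|u (e i) - z (e i)|)
    (fun i => nrm N (psi i)) z (fun i => evc (e i)).
  exact: (cvgr_lt _ Fc _ dl0).
move=> u du u1 [Fu uy].
have hu := du.1; have hz := dz.1.
pose v x := u x + (-1) * z x.
have dv : dual N v by exact: dual_comb.
pose p x := \sum_i v (e i) * psi i x.
have dp : dual N p by exact: dual_sum.
have pF : nrm N p <= dl.
  apply: nrm_le => [//||x]; first exact: ltW.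
  apply: le_trans (ler_norm_sum _ _ _) _.
  apply: le_trans (_ : F u * N x <= _); last first.
    by apply: ler_wpM2r; [have [] := hN | exact: ltW].
  rewrite /F mulr_suml; apply: ler_sum => i _.
  by rewrite normrM /v mulN1r -mulrA ler_wpM2l // nrm_ub.
pose w x := v x + (-1) * p x.
have dw : dual N w by exact: dual_comb.
have aw : annihilator N E w.
  split=> // x Ex; rewrite /w {1}(eP _ Ex) (scalar_sum _ dv.1) /p.
  rewrite mulN1r; apply/eqP; rewrite subr_eq0; apply/eqP; apply: eq_bigr => i _.
  by rewrite (scalarZ _ dv.1) mulrC.
have zw : nrm N (fun x => z x + w x) <= 1 + dl.
  have -> : (fun x => z x + w x) = (fun x => u x + (-1) * p x).
    by apply/funext => x; rewrite /w /v; ring.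
  apply: le_trans (nrm_comb N hN u p (-1) du dp) _.
  by rewrite normrN normr1 mul1r lerD.
have [C1 C2] := EP w _ aw zw.
exists (nrm N w); split=> // [||x]; first exact: nrm_ge0.
  by have := ler_norm (u y - z y); lra.
have -> : u x - z x = w x + p x by rewrite /w /v; ring.
rewrite mulrDl lerD //.
  by apply: le_trans (ler_norm _) _; exact: nrm_ub.
apply: le_trans (ler_norm _) _; apply: le_trans (nrm_ub N hN p x dp) _.
by apply: ler_wpM2r => //; have [] := hN.
Qed.

(** The finite codimensional subspace is the common kernel of the centres of a
    finite weak-star cover of the dual ball by the neighbourhoods of
    [dual_growth_near]. Of the functional which norms [y + z], only the part
    [lam] sees [y] and only the part [tau] sees [z]. *)
Lemma asymptotic_norm y (dl : R) : 0 < dl -> fin_codim N [set z | exists lam tau : R,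
  [/\ 0 <= lam <= 1, 0 <= tau, s * lam <= tau -> lam + sg * tau <= 1 + dl,
   tau <= s * lam -> lam * (1 + th - s) + tau <= 1 + dl &
   N (y + z) <= lam * N y + tau * N z + dl * (1 + N z) /\
   N (y + z) <= lam * N y + N z + dl]].
Proof.
move=> dl0; pose B : set (V -> R) := [set u | dual N u /\ nrm N u <= 1].
have cB : compact (B : set {ptws V -> R}).
  have -> : B = [set u | scalar u /\ forall x, `|u x| <= N x].
    apply/seteqP; split=> u [hu uN].
      split=> [|x]; first exact: hu.1.
      apply: le_trans (nrm_ub N hN u x hu) _; rewrite ler_piMl //; by have [] := hN.
    have uN' x : `|u x| <= 1 * N x by rewrite mul1r.
    by split; [split=> //; exists 1 | exact: nrm_le].
  exact: alaoglu.
have /choice[U UP] : forall z : {ptws V -> R}, exists U : set {ptws V -> R}, B z -> nbhs z U /\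
    forall u, dual N u -> nrm N u <= 1 -> U u -> exists tau,
    [/\ 0 <= tau, s * nrm N z <= tau -> nrm N z + sg * tau <= 1 + dl,
     tau <= s * nrm N z -> nrm N z * (1 + th - s) + tau <= 1 + dl,
     u y <= z y + dl & forall x, u x - z x <= (tau + dl) * N x].
  move=> z; have [[dz z1]|nB] := pselect (B z); last by exists setT.
  by have [U UP] := dual_growth_near z dl y dz z1 dl0; exists U.
have [n [p [Bp pU]]] := compact_finite_pick _ _ U cB (fun z Bz => (UP z Bz).1).
exists n, p; split=> [i|z pz]; first exact: (Bp i).1.
have [u [du u1 uyz]] := norming N hN (y + z).
have [i Ui] := pU u (conj du u1).
have [tau [tau0 C1 C2 uy ux]] := (UP _ (Bp i)).2 u du u1 Ui.
have [dp p1] := Bp i; have [N0 _ _ _] := hN.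
exists (nrm N (p i)), tau; split=> //; first by rewrite nrm_ge0.
have py : p i y <= nrm N (p i) * N y.
  by apply: le_trans (ler_norm _) _; exact: nrm_ub.
have uz : u z <= N z.
  apply: le_trans (ler_norm _) _; apply: le_trans (nrm_ub N hN u z du) _.
  by rewrite ler_piMl.
have := ux z; rewrite pz subr0 mulrDl => uz'.
by rewrite -uyz (scalarD _ du.1); split; have := N0 z; lra.
Qed.

End Asymptotic.

(** * Asymptotic averages and almost linear points *)

Section Iteration.
Context {R : realType} {V : lmodType R}.
Variable N : V -> R.
Hypothesis hN : is_norm N.
Variables s th : R.
Hypotheses (s0 : 0 < s) (s4 : s <= 4^-1) (th0 : 0 < th) (ths : th <= s).
Hypothesis cvx : asym_convex N s th.

Local Notation sg := (th / s).

Let sg0 : 0 < sg. Proof. by rewrite divr_gt0. Qed.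
Let sg1 : sg <= 1. Proof. by rewrite ler_pdivrMr // mul1r. Qed.

(** Maximize [lam + sg tau] under the constraints of [asymptotic_norm]. *)
Lemma asymptotic_growth y e : 0 < e -> fin_codim N [set z |
  N z <= sg * N y -> N (y + z) <= N y * (1 + sg * (s - th)) + e].
Proof.
move=> e0; have [N0 _ _ _] := hN; set l := N y; have l0 : 0 <= l by exact: N0.
pose dl := e / (1 + 2 * l).
have dl0 : 0 < dl by rewrite divr_gt0 //; lra.
apply: fin_codimS (asymptotic_norm N hN s th s0 ths cvx y dl dl0) => z.
move=> [lam [tau [/andP[lam0 lam1] tau0 C1 C2 [B _]]]] zl; apply: le_trans B _.
have dlE : dl * (1 + 2 * l) = e by rewrite /dl divfK // gt_eqF //; lra.
have tz : tau * N z <= tau * (sg * l) by exact: ler_wpM2l.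
have dz : dl * N z <= dl * l.
  by rewrite ler_pM2l //; apply: le_trans zl _; rewrite ler_piMl.
have key : lam + sg * tau <= 1 + sg * (s - th) + dl.
  have [c1|c2] := leP (s * lam) tau.
    have := C1 c1; have : 0 <= sg * (s - th) by rewrite mulr_ge0 ?subr_ge0 // ltW.
    lra.
  have H1 := C2 (ltW c2).
  have H2 : sg * (lam * (1 + th - s) + tau) <= sg * (1 + dl) by rewrite ler_pM2l.
  have H3 : 0 <= (1 - lam) * (1 - sg * (1 + th - s)).
    rewrite mulr_ge0 ?subr_ge0 //; apply: le_trans sg1.
    by rewrite ler_piMr ?(ltW sg0) // -addrA gerDl subr_le0.
  have H4 : sg * dl <= dl by rewrite ler_piMl // ltW.
  have -> : lam + sg * tau = sg * (lam * (1 + th - s) + tau) + 1 - sg * (1 + th - s)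
     - (1 - lam) * (1 - sg * (1 + th - s)) by ring.
  have -> : 1 + sg * (s - th) + dl = sg * (1 + dl) + 1 - sg * (1 + th - s) + (dl - sg * dl) by ring.
  lra.
have key' : l * (lam + sg * tau) <= l * (1 + sg * (s - th) + dl) by exact: ler_wpM2l.
have E1 : l * (lam + sg * tau) = lam * l + tau * (sg * l) by ring.
have E2 : l * (1 + sg * (s - th) + dl) = l * (1 + sg * (s - th)) + dl * l by ring.
rewrite E1 E2 in key'.
have E3 : dl * (1 + 2 * l) = dl + dl * l + dl * l by ring.
have E4 : dl * (1 + N z) = dl + dl * N z by ring.
rewrite -/l E4 -dlE E3; lra.
Qed.

(** The improvement on the triangle inequality, by the factor [1 - sg / 4]. *)
Lemma asymptotic_doubling y a : 0 < a -> N y <= a -> fin_codim N [set z |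
  N z <= a -> N (y + z) <= (2 - sg / 2) * a].
Proof.
move=> a0 ya; have [N0 _ _ _] := hN.
pose dl := sg * a / (4 * (1 + a)).
have a1 : 0 < 1 + a by exact: addr_gt0.
have dl0 : 0 < dl by rewrite divr_gt0 // mulr_gt0.
apply: fin_codimS (asymptotic_norm N hN s th s0 ths cvx y dl dl0) => z.
move=> [lam [tau [/andP[lam0 lam1] tau0 C1 C2 [B1 B2]]]] za.
have dlE : dl * (1 + a) = sg * a / 4.
  by rewrite /dl; field; rewrite !gt_eqF.
have sga : sg * a <= a by rewrite ler_piMl // ltW.
have dla : 0 < dl * a by rewrite mulr_gt0.
have dlE' : dl + dl * a = sg * a / 4 by rewrite -dlE; ring.
have ly : lam * N y <= lam * a by exact: ler_wpM2l.
have lam1a : lam * a <= a by rewrite ler_piMl // ltW.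
have tz : tau * N z <= tau * a by exact: ler_wpM2l.
have dz : dl * N z <= dl * a by rewrite ler_pM2l.
have -> : (2 - sg / 2) * a = 2 * a - sg * a / 2 by ring.
rewrite mulrDr mulr1 in B1.
have [c1|c2] := leP (s * lam) tau.
  have c3 := C1 c1; have [t1|t1] := leP tau 1.
    have H1 : (lam + sg * tau) * a <= (1 + dl) * a by rewrite ler_pM2r.
    have H2 : 0 <= (1 - sg) * (1 - tau) * a by rewrite !mulr_ge0 ?subr_ge0 // ltW.
    have E : lam * a + tau * a = (lam + sg * tau) * a + a - sg * a - (1 - sg) * (1 - tau) * a by ring.
    have E2 : (1 + dl) * a = a + dl * a by ring.
    lra.
  have H1 : (lam + sg) * a <= (1 + dl) * a.
    rewrite ler_pM2r //; apply: le_trans c3; rewrite lerD2l.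
    by rewrite ler_peMr ?(ltW sg0) // ltW.
  have E2 : (1 + dl) * a = a + dl * a by ring.
  have E3 : (lam + sg) * a = lam * a + sg * a by ring.
  lra.
have H1 : tau * a <= 4^-1 * a.
  rewrite ler_pM2r //; apply: le_trans (ltW c2) _; apply: le_trans s4.
  by rewrite ler_piMr // ltW.
lra.
Qed.

(** A game with [n] rounds: in each of them the first player chooses a subspace of
    finite codimension, and the second one answers with a vector of norm at most
    [D] in it. The first player can bring [e] plus the sum of the answers into
    [S]. *)
Fixpoint forced (D : R) (n : nat) (S : set V) (e : V) : Prop :=
  if n is n'.+1 then fin_codim N [set z | N z <= D -> forced D n' S (e + z)] else S e.

Lemma forcedS D n (S T : set V) e : S `<=` T -> forced D n S e -> forced D n T e.
Proof.
move=> ST; elim: n e => [|n IH] e /=; first exact: ST.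
by apply: fin_codimS => z h /h; exact: IH.
Qed.

Lemma forced_add D m n (S : set V) e :
  forced D m [set x | forced D n S x] e -> forced D (m + n) S e.
Proof.
elim: m e => [|m IH] e //=; apply: fin_codimS => z h /h; exact: IH.
Qed.

Lemma forced_level D k (phi : 'I_k -> V -> R) n (S : set V) (c : 'I_k -> R) e :
  (forall i, dual N (phi i)) -> (forall i, phi i e = c i) ->
  forced D n S e -> forced D n (S `&` [set x | forall i, phi i x = c i]) e.
Proof.
move=> dphi; elim: n e => [|n IH] e ec //= F.
have K : fin_codim N [set z | forall i, phi i z = 0] by exists k, phi.
apply: fin_codimS (fin_codimI N _ _ F K) => z [h pz] /h; apply: IH => i.
by rewrite (scalarD _ (dphi i).1) pz addr0.
Qed.

Lemma forced_translate D n (S : set V) v e :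
  forced D n S e -> forced D n [set x | S (x - v)] (e + v).
Proof.
elim: n e => [|n IH] e /=; first by rewrite addrK.
by apply: fin_codimS => z h /h /IH; rewrite addrAC.
Qed.

(** The second half of the game is played as the first one, but inside the
    subspace which [asymptotic_doubling] provides for the sum [y] reached after
    the first half. *)
Lemma forced_double D n a : 0 < a -> forced D n [set x | N x <= a] 0 ->
  forced D (n + n) [set x | N x <= (2 - sg / 2) * a] 0.
Proof.
move=> a0 F; apply: forced_add; apply: forcedS (F) => y /= ya.
have [k [phi [dphi P]]] := asymptotic_doubling y a a0 ya.
have phi0 i : phi i 0 = 0 by exact: (scalar0 _ (dphi i).1).
have := forced_translate D n _ y _ (forced_level D k phi n _ (fun=> 0) 0 dphi phi0 F).
rewrite add0r; apply: forcedS => x /= [xya px].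
by have := P (x - y) px xya; rewrite addrC subrK.
Qed.

Lemma forced_pow D k : 0 < D ->
  forced D (2 ^ k) [set x | N x <= (2 - sg / 2) ^+ k * D] 0.
Proof.
have g1 := sg1.
move=> D0; elim: k => [|k IH].
  by apply: fin_codimS (fin_codimT N) => z _ /= zD; rewrite add0r expr0 mul1r.
rewrite expnS mul2n -addnn exprS -mulrA; apply: forced_double => //.
by rewrite mulr_gt0 ?exprn_gt0 //; lra.
Qed.

Lemma forced_average (al : R) : 0 < al -> exists2 n, (0 < n)%N &
  forall D, 0 < D -> forced D n [set x | N x <= n%:R * (al * D)] 0.
Proof.
have g0 := sg0; have g1 := sg1.
move=> al0; have [k kP] : exists k : nat, (1 - sg / 4) ^+ k < al.
  have q1 : `|1 - sg / 4| < 1 by rewrite ger0_norm; lra.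
  have /cvgrPdist_lt /(_ _ al0) [k _ kP] := cvg_expr q1.
  exists k; have := kP k (leqnn k); rewrite sub0r normrN.
  by apply: le_lt_trans; exact: ler_norm.
exists (2 ^ k)%N; first by rewrite expn_gt0.
move=> D D0; apply: forcedS (forced_pow D k D0) => x /= xD; apply: le_trans xD _.
rewrite natrX mulrA ler_pM2r //.
have -> : 2 - sg / 2 = 2 * (1 - sg / 4) by lra.
by rewrite exprMn ler_pM2l ?exprn_gt0 // ltW.
Qed.

Section GoodPoint.
Variable h : V -> R.
Hypothesis hL : forall x y, h x - h y <= N (x - y).
Hypothesis hsup : forall e : R, 0 < e -> exists x y, (1 - e) * N (x - y) < h x - h y.

(** On the line through [c0 + e] with direction [v], the function [H e] measures
    how far [h] is ahead of the linear function of slope [1]; it is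
    nonincreasing, and its total variation is bounded independently of the
    length [L] of the segment. So among [K] unit steps there is one on which
    [h] has slope almost [1], and if no such step satisfies the conclusion, the
    second player can answer with some [z] that adds [eta * l] to [H]. *)
Lemma good_point (e1 eta : R) : 0 < e1 -> 0 < eta -> exists m v, [/\ 0 < N v,
  (1 - e1) * N v <= h (m + v) - h m &
  fin_codim N [set z | N z <= sg * N v -> h (m + z) <= h m + eta * N v]].
Proof.
move=> e10 eta0; have [N0 _ ND NZ] := hN.
have g0 := sg0; have g1 := sg1.
have al0 : 0 < eta / 2 / sg by rewrite !divr_gt0.
have [n n0 avg] := forced_average (eta / 2 / sg) al0.
have nR : 0 < n%:R :> R by rewrite ltr0n.
(* [1 + 2 n] bounds the variation of [H e] in units of [l]. *)
pose K := (Num.truncn ((1 + 2 * n%:R) / e1)).+1.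
have KP : 1 + 2 * n%:R < K%:R * e1.
  by rewrite -ltr_pdivrMr //; apply: truncnS_gt.
(* All [n] moves, each going back by at most [K], stay inside the segment. *)
pose L := (n * K).+1.
have L0 : 0 < L%:R :> R by rewrite ltr0n.
pose ep := Num.min 1 (n%:R * eta / 4) / (2 * L%:R).
have mn0 : 0 < Num.min 1 (n%:R * eta / 4) :> R.
  by rewrite lt_min ltr01 divr_gt0 ?mulr_gt0.
have ep0 : 0 < ep by rewrite divr_gt0 // mulr_gt0.
have epE : 2 * L%:R * ep = Num.min 1 (n%:R * eta / 4).
  by rewrite /ep mulrC divfK // gt_eqF // mulr_gt0.
have [P [Q PQ]] := hsup ep ep0.
have d0 : 0 < N (P - Q).
  rewrite lt_neqAle N0 andbT eq_sym; apply/eqP => d0.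
  by have := hL P Q; move: PQ; rewrite d0 mulr0 => /lt_le_trans h1 /h1; rewrite ltxx.
pose v := (2 * L%:R)^-1 *: (P - Q); pose c0 := 2^-1 *: (P + Q).
pose l := N v.
have L2 : 0 < 2 * L%:R :> R by rewrite mulr_gt0.
have dl : N (P - Q) = 2 * L%:R * l.
  rewrite /l /v NZ ger0_norm ?invr_ge0 ?(ltW L2) // mulrA divff ?mul1r //.
  by rewrite gt_eqF.
have l0 : 0 < l by move: d0; rewrite dl pmulr_rgt0.
have PQv : L%:R *: v = 2^-1 *: (P - Q).
  rewrite /v scalerA; congr (_ *: _); field; exact: lt0r_neq0.
have PE : c0 + L%:R *: v = P.
  rewrite PQv /c0 -scalerDr addrACA subrr addr0 -[P + P]mulr2n -[P *+ 2]scaler_nat scalerA.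
  by rewrite mulVf ?scale1r.
have QE : c0 - L%:R *: v = Q.
  rewrite PQv /c0 -scalerBr opprB addrC addrA subrK -[Q + Q]mulr2n -[Q *+ 2]scaler_nat scalerA.
  by rewrite mulVf ?scale1r.
have hPQ : h Q - h P + 2 * L%:R * l <= Num.min 1 (n%:R * eta / 4) * l.
  rewrite -epE; move: PQ; rewrite dl mulrBl mul1r; lra.
pose H e c := h (c0 + e + c *: v) - c * l.
have Hmono e c c' : c <= c' -> H e c' <= H e c.
  move=> cc'; have := hL (c0 + e + c' *: v) (c0 + e + c *: v).
  rewrite opprD addrACA subrr add0r -scalerBl NZ ger0_norm ?subr_ge0 // -/l /H; lra.
have Hup e c : - L%:R <= c -> H e c <= h Q + L%:R * l + N e.
  move=> cL; have := hL (c0 + e + c *: v) Q.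
  have -> : c0 + e + c *: v - Q = e + (c + L%:R) *: v.
    rewrite -QE opprB scalerDl [c0 + e]addrC -!addrA; congr (e + _).
    by rewrite addrC -!addrA addNr addr0.
  move=> hh; have := ND e ((c + L%:R) *: v).
  rewrite NZ ger0_norm; last by lra.
  by rewrite -/l /H; lra.
have Hlow e c : c <= L%:R -> h P - L%:R * l - N e <= H e c.
  move=> cL; have := hL P (c0 + e + c *: v).
  have -> : P - (c0 + e + c *: v) = - e + (L%:R - c) *: v.
    by apply/eqP; rewrite subr_eq -PE scalerBl addrACA subrK [- e + _]addrC addrK.
  move=> hh; have := ND (- e) ((L%:R - c) *: v).
  rewrite (normN N hN) NZ ger0_norm ?subr_ge0 //.
  by rewrite -/l /H; lra.
apply: contrapT => bad.
have {}bad m : (1 - e1) * l <= h (m + v) - h m ->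
    ~ fin_codim N [set z | N z <= sg * l -> h (m + z) <= h m + eta * l].
  by move=> h1 h2; apply: bad; exists m, v.
have pigeon e c : N e <= n%:R * l -> c <= 0 -> - L%:R <= c - K%:R ->
    exists2 c', c - K%:R <= c' <= c & H e c' - H e (c' + 1) <= e1 * l.
  move=> ne cz cL; apply: contrapT => nc.
  have steps (i : nat) : (i <= K)%N -> i%:R * (e1 * l) <= H e (c - i%:R) - H e c.
    elim: i => [|i IH] iK; first by rewrite mul0r subr0 subrr.
    have {}IH := IH (ltnW iK).
    have lt1 : e1 * l < H e (c - i.+1%:R) - H e (c - i.+1%:R + 1).
      rewrite ltNge; apply/negP => le1; apply: nc; exists (c - i.+1%:R) => //.
      by rewrite lerD2l lerN2 ler_nat iK /= gerBl.
    have E : c - i.+1%:R + 1 = c - i%:R by rewrite -natr1; ring.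
    rewrite E in lt1.
    have E' : i.+1%:R * (e1 * l) = i%:R * (e1 * l) + e1 * l by rewrite -natr1 mulrDl mul1r.
    rewrite E'; lra.
  have := steps K (leqnn K).
  have := Hup e (c - K%:R) cL; have := Hlow e c (le_trans cz (ltW L0)).
  have K1 : (1 + 2 * n%:R) * l < K%:R * e1 * l by rewrite ltr_pM2r.
  have K2 : Num.min 1 (n%:R * eta / 4) * l <= l.
    by rewrite ler_piMl ?ge_min ?lexx // ltW.
  have K3 : (1 + 2 * n%:R) * l = l + 2 * (n%:R * l) by ring.
  have K4 : K%:R * e1 * l = K%:R * (e1 * l) by rewrite mulrA.
  have K5 : 2 * L%:R * l = 2 * (L%:R * l) by rewrite mulrA.
  rewrite K5 in hPQ; rewrite K3 K4 in K1; lra.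
have main k j e c : (j + k)%N = n ->
    forced (sg * l) k [set x | N x <= n%:R * (eta / 2 / sg * (sg * l))] e ->
    N e <= j%:R * l -> c <= 0 -> - (j * K)%:R <= c -> H 0 0 + j%:R * (eta * l) <= H e c ->
    False.
  elim: k j e c => [|k IH] j e c.
    rewrite addn0 => -> /= Ne _ _ cK Hec.
    have cL : - L%:R <= c by apply: le_trans cK; rewrite lerN2 ler_nat.
    have := Hup e c cL; have := Hlow 0 0 (ltW L0); rewrite (norm0 N hN) subr0.
    have E : n%:R * (eta / 2 / sg * (sg * l)) = n%:R * eta * l / 2.
      by field; rewrite !gt_eqF.
    rewrite E in Ne.
    have : Num.min 1 (n%:R * eta / 4) * l <= n%:R * eta / 4 * l.
      by rewrite ler_pM2r // ge_min lexx orbT.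
    have : 0 < n%:R * eta * l by rewrite !mulr_gt0.
    move: Hec; rewrite mulrA; lra.
  move=> jk F Ne cz cK Hec.
  have jn : (j.+1 <= n)%N by rewrite -jk addnS ltnS leq_addr.
  have jn' : j%:R <= n%:R :> R by rewrite ler_nat ltnW.
  have Ne' : N e <= n%:R * l by apply: le_trans Ne _; rewrite ler_pM2r.
  have cK' : - (j.+1 * K)%:R <= c - K%:R by rewrite mulSn natrD opprD; lra.
  have cL : - L%:R <= c - K%:R.
    apply: le_trans cK'; rewrite lerN2 ler_nat /L; apply: leqW.
    by rewrite leq_mul2r jn orbT.
  have [c' /andP[c1 c2] Hc'] := pigeon e c Ne' cz cL.
  pose m := c0 + e + c' *: v.
  have mv : (1 - e1) * l <= h (m + v) - h m.
    have E : m + v = c0 + e + (c' + 1) *: v by rewrite scalerDl scale1r addrA.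
    by move: Hc'; rewrite /H -E -/m mulrBl mul1r; lra.
  have [z [Fz zl hz]] : exists z, [/\
      forced (sg * l) k [set x | N x <= n%:R * (eta / 2 / sg * (sg * l))] (e + z),
      N z <= sg * l & h m + eta * l < h (m + z)].
    apply: contrapT => nz; apply: (bad m mv).
    apply: fin_codimS F => z /= Fz zl; rewrite leNgt; apply/negP => hz.
    by apply: nz; exists z; split=> //; exact: Fz.
  apply: (IH j.+1 (e + z) c') => //.
  - by rewrite addSnnS.
  - apply: le_trans (ND _ _) _; rewrite -natr1 mulrDl mul1r lerD //.
    by apply: le_trans zl _; rewrite ler_piMl // ltW.
  - exact: le_trans c2 cz.
  - exact: le_trans cK' c1.
  - have -> : H (e + z) c' = H e c' + (h (m + z) - h m).
      have E : c0 + (e + z) + c' *: v = m + z.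
        by rewrite /m -!addrA; congr (_ + (_ + _)); exact: addrC.
      by rewrite /H E -/m; ring.
    have E' : j.+1%:R * (eta * l) = j%:R * (eta * l) + eta * l by rewrite -natr1 mulrDl mul1r.
    have := Hmono e _ _ c2; rewrite E'; lra.
apply: (main n 0%N 0 0) => //.
- by apply: avg; rewrite mulr_gt0.
- by rewrite (norm0 N hN) mul0r.
- by rewrite mul0r addr0.
Qed.

End GoodPoint.
End Iteration.

(** * The Gorelik principle *)

Lemma lipschitz_continuous_map (R : realType) (V W : normedModType R) (g : V -> W) (K : R) :
  (forall x y, `|g x - g y| <= K * `|x - y|) -> continuous g.
Proof.
move=> gK x; apply/cvgrPdist_lt => e e0.
have K0 : 0 < `|K| + 1 by rewrite ltr_wpDl.
have d0 : 0 < e / (`|K| + 1) by rewrite divr_gt0.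
have nb := nbhsx_ballx x _ d0.
apply: filterS nb => y; rewrite -ball_normE /= ltr_pdivlMr // => xy.
apply: le_lt_trans (gK x y) _; apply: le_lt_trans xy.
rewrite mulrC ler_wpM2l //; apply: le_trans (ler_norm K) _; lra.
Qed.

Section VectorContinuity.
Context {R : realType} {T : topologicalType} {V W : normedModType R}.

Lemma continuous_translate (u : T -> V) a b : continuous u ->
  continuous (fun t => a + u t - b).
Proof.
move=> uc t; have H : (a + u s) @[s --> t] --> a + u t.
  by exact: (cvgD (@cvg_cst V a _ (nbhs t) _) (uc t)).
by exact: (cvgB H (@cvg_cst V b _ (nbhs t) _)).
Qed.

Lemma continuous_after (g : V -> W) (u : T -> V) :
  continuous g -> continuous u -> continuous (fun t => g (u t)).
Proof. by move=> gc uc t; exact: (continuous_cvg _ (gc (u t)) (uc t)). Qed.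

End VectorContinuity.

Section Gorelik.
Context {R : realType} {X Y : normedModType R}.
Variables (f : X -> Y) (finv : Y -> X) (M : R).
Hypotheses (fK : cancel f finv) (finvK : cancel finv f).
Hypothesis fL : forall x y, `|f x - f y| <= `|x - y|.
Hypothesis finvL : forall x y, `|finv x - finv y| <= M * `|x - y|.
Hypothesis M0 : 0 <= M.

Local Notation N := (fun x : X => `|x|).
Let hN : is_norm N := normr_is_norm R X.

Section Family.
Variables (n : nat) (phi : 'I_n -> X -> R).
Hypothesis dphi : forall i, dual N (phi i).
Lemma nrm_sum_dist (c c' : 'I_n -> R) :
  nrm N (fun x => \sum_i c' i * phi i x) <=
  nrm N (fun x => \sum_i c i * phi i x) + \sum_i `|c' i - c i| * nrm N (phi i).
Proof.
have S0 : 0 <= \sum_i `|c' i - c i| * nrm N (phi i).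
  by apply: sumr_ge0 => i _; apply: mulr_ge0 => //; exact: nrm_ge0.
have dc : dual N (fun x => \sum_i c i * phi i x) by exact: dual_sum.
apply: nrm_le => [//||x]; first by apply: addr_ge0 => //; exact: nrm_ge0.
have -> : \sum_i c' i * phi i x = \sum_i c i * phi i x + \sum_i (c' i - c i) * phi i x.
  by rewrite -big_split /=; apply: eq_bigr => i _; ring.
apply: le_trans (ler_normD _ _) _; rewrite mulrDl lerD //; first exact: (nrm_ub N hN _ x dc).
apply: le_trans (ler_norm_sum _ _ _) _; rewrite mulr_suml; apply: ler_sum => i _.
by rewrite normrM -mulrA ler_wpM2l //; exact: (nrm_ub N hN).
Qed.

Let Phi (c : 'I_n -> R) (x : X) : R := \sum_i c i * phi i x.

Let dPhi c : dual N (Phi c). Proof. exact: dual_sum. Qed.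

(** Each nonzero functional in the span of [phi] is below [- r] times its norm at some
    vector of norm at most [d]; compactness of the sphere of the span makes
    finitely many vectors sufficient. *)
Lemma norming_net (r d : R) : 0 <= r -> r < d ->
  (forall c : 'I_n -> R, (forall z, \sum_i c i * phi i z = 0) -> forall i, c i = 0) ->
  exists k (a : 'I_k -> X), (forall i, `|a i| <= d) /\
    forall c : 'I_n -> R, (exists j, c j <> 0) -> exists i,
      \sum_j c j * phi j (a i) + r * nrm N (fun x => \sum_j c j * phi j x) < 0.
Proof.
move=> r0 rd indep; have d0 : 0 < d by exact: le_lt_trans rd.
pose sph : set 'rV[R]_n := [set c | (forall i, `[-1, 1]%classic (c 0 i)) /\ \sum_i `|c 0 i| = 1].
have csph : compact sph.
  have cB : compact [set c : 'rV[R]_n | forall i, (`[-1, 1]%classic : set R) (c 0 i)].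
    by apply: (@rV_compact _ n (fun=> (`[-1, 1]%classic : set R))) => i; exact: segment_compact.
  apply: subclosed_compact (cB) _; last by move=> c [].
  have -> : sph = [set c : 'rV[R]_n | forall i, `[-1, 1]%classic (c 0 i)] `&`
      (fun c : 'rV[R]_n => \sum_i `|c 0 i|) @^-1` [set 1].
    by apply/seteqP; split => c.
  apply: closedI.
    by apply: compact_closed cB; exact: norm_hausdorff.
  apply: (continuous_closedP _).1 (@closed_eq R 1) => c.
  apply: (@cvg_big R 'I_n +%R 0 xpredT (@add_continuous R) _ (nbhs c) (index_enum _)
    (fun i (t : 'rV[R]_n) => `|t 0 i|) (fun i => `|c 0 i|)) => i _.
  by apply: cvg_norm; exact: coord_continuous.
have /choice[a aP] : forall c : 'rV[R]_n, exists x : X, sph c ->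
    `|x| <= d /\ Phi (c 0) x + r * nrm N (Phi (c 0)) < 0.
  move=> c; have [[_ c1]|nc] := pselect (sph c); last by exists 0.
  set u := Phi (c 0); have np : 0 < nrm N u.
    have un : 0 <= nrm N u := nrm_ge0 N hN u (dPhi _).
    rewrite lt_neqAle eq_sym un andbT; apply/eqP => u0.
    have c0 i : c 0 i = 0.
      apply: indep => z; apply/eqP; rewrite -normr_le0.
      by have := nrm_ub N hN u z (dPhi _); rewrite u0 mul0r.
    move: c1; rewrite big1 => [/eqP|i _]; first by rewrite eq_sym oner_eq0.
    by rewrite c0 normr0.
  have e0 : 0 < nrm N u * (1 - r / d).
    by rewrite mulr_gt0 // subr_gt0 ltr_pdivrMr // mul1r.
  have [x x1 ux] := nrm_adherent N hN u _ (dPhi _) e0.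
  exists (- d *: x) => _; split.
    by rewrite normrZ normrN gtr0_norm // ler_piMr // ltW.
  rewrite (scalarZ u (dPhi _).1).
  have : d * (nrm N u - nrm N u * (1 - r / d)) < d * u x by rewrite ltr_pM2l.
  have -> : d * (nrm N u - nrm N u * (1 - r / d)) = r * nrm N u.
    by field; rewrite gt_eqF.
  lra.
pose U (c : 'rV[R]_n) : set 'rV[R]_n :=
  [set c' | Phi (c' 0) (a c) + r * nrm N (Phi (c' 0)) < 0].
have [k [p [sp pU]]] : exists k (p : 'I_k -> 'rV[R]_n), (forall i, sph (p i)) /\
    forall c, sph c -> exists i, U (p i) c.
  apply: compact_finite_pick csph _ => c sc.
  have [_ neg] := aP c sc; set v := _ + _ in neg.
  have S0 := @cvg_sum0 R 'rV[R]_n n (fun i t => `|t 0 i - c 0 i|)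
    (fun i => `|phi i (a c)| + r * nrm N (phi i)) c
    (fun i => @cvg_dist0 R 'rV[R]_n (fun t => t 0 i) c (@coord_continuous R 1 n 0 i)).
  have v0 : 0 < - v by rewrite oppr_gt0.
  apply: filterS (cvgr_lt _ S0 _ v0) => c' /= Sv; rewrite /U /=.
  have H1 : r * nrm N (Phi (c' 0)) <=
      r * (nrm N (Phi (c 0)) + \sum_i `|c' 0 i - c 0 i| * nrm N (phi i)).
    by apply: ler_wpM2l => //; exact: nrm_sum_dist.
  have H2 : Phi (c' 0) (a c) <= Phi (c 0) (a c) + \sum_i `|c' 0 i - c 0 i| * `|phi i (a c)|.
    rewrite /Phi -big_split /=; apply: ler_sum => i _.
    by rewrite -lerBlDl -mulrBl -normrM ler_norm.
  have E : \sum_i `|c' 0 i - c 0 i| * (`|phi i (a c)| + r * nrm N (phi i)) =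
     \sum_i `|c' 0 i - c 0 i| * `|phi i (a c)| + r * \sum_i `|c' 0 i - c 0 i| * nrm N (phi i).
    by rewrite mulr_sumr -big_split /=; apply: eq_bigr => i _; ring.
  rewrite E /v in Sv; rewrite mulrDr in H1; lra.
exists k, (fun i => a (p i)); split=> [i|c [j cj]]; first exact: (aP _ (sp i)).1.
pose t := \sum_i `|c i|.
have t0 : 0 < t.
  rewrite /t (bigD1 j) //= ltr_pwDl ?normr_gt0 //; first exact/eqP.
  by apply: sumr_ge0.
pose c1 : 'rV[R]_n := \row_i (t^-1 * c i).
have sc1 : sph c1.
  have E : \sum_i `|c1 0 i| = 1.
    under eq_bigr do rewrite mxE normrM.
    by rewrite -mulr_sumr -/t ger0_norm ?invr_ge0 ?(ltW t0) // mulVf // gt_eqF.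
  split=> // i; rewrite /= in_itv /= -ler_norml -E (bigD1 i) //= lerDl.
  by apply: sumr_ge0.
have [i Ui] := pU c1 sc1; exists i; move: Ui; rewrite /U /=.
have E : Phi (c1 0) = (fun x => t^-1 * Phi c x).
  apply/funext => x; rewrite /Phi mulr_sumr; apply: eq_bigr => l _.
  by rewrite mxE mulrA.
rewrite E (nrmZ N hN) // ger0_norm ?invr_ge0 ?(ltW t0) // mulrCA -mulrDr.
by rewrite pmulr_rlt0 // invr_gt0.
Qed.

End Family.

(** Let [T] be the map [x |-> f^-1 (y + f (m + x)) - m], which moves points by at
    most [M * b], and let [phi] cut out [S]. One looks for [x = T a] in the kernel
    of [phi], with [a] in the convex hull of [0] and of a norming net. The
    functional [u = \sum_i phi i (T a) *: phi i] depends continuously on [a], and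
    [cube_complementarity] provides an [a] whose weights are carried by vectors
    of the net at which [u] is at most [- M * b * |u|]. Then [u (T a) <= 0], while
    [u (T a) = \sum_i phi i (T a) ^+ 2]. *)
Lemma gorelik (S : set X) (m : X) (b d C e : R) : fin_codim N S -> 0 <= b -> M * b < d ->
  0 < C -> 0 < e ->
  exists E : set Y, fin_dim_subspace E /\
  forall w : Y -> R, scalar w -> (forall y, `|w y| <= C * `|y|) ->
    (forall y, E y -> w y = 0) -> forall y, `|y| <= b ->
    exists z, [/\ S z, `|z| <= 2 * d & w (f (m + z) - f m) <= w y + e].
Proof.
move=> /(fin_codim_independent N)[n [phi [dphi SP indep]]] b0 Mbd C0 e0.
have r0 : 0 <= M * b by exact: mulr_ge0.
have d0 : 0 < d by exact: le_lt_trans Mbd.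
pose Phi (c : 'I_n -> R) (x : X) : R := \sum_i c i * phi i x.
have [k [a [ad aP]]] := norming_net n phi dphi (M * b) d r0 Mbd indep.
(* The maximum of [1] and of the sum of the weights. *)
pose mx (c : 'rV[R]_k) : R := (1 + \sum_i c 0 i + `|1 - \sum_i c 0 i|) / 2.
pose A (c : 'rV[R]_k) : X := (mx c)^-1 *: \sum_i c 0 i *: a i.
have mx1 c : 1 <= mx c.
  by rewrite /mx; have := ler_norm (1 - \sum_i c 0 i); lra.
have mxS (c : 'rV[R]_k) : \sum_i c 0 i <= mx c.
  by rewrite /mx; have := ler_norm (- (1 - \sum_i c 0 i)); rewrite normrN; lra.
have mxE' (c : 'rV[R]_k) : 1 <= \sum_i c 0 i -> mx c = \sum_i c 0 i.
  by move=> h; rewrite /mx ler0_norm ?subr_le0 //; lra.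
have mx0 c : 0 < mx c by exact: lt_le_trans (mx1 c).
have coordc i := @coord_continuous R 1 k 0 i.
have sumc : continuous (fun c : 'rV[R]_k => \sum_i c 0 i).
  move=> c; apply: (@cvg_big R 'I_k +%R 0 xpredT (@add_continuous R) _ (nbhs c) (index_enum _)
    (fun i (t : 'rV[R]_k) => t 0 i) (fun i => c 0 i)) => i _; exact: coordc.
have mxc : continuous mx.
  move=> c; pose sm (t : 'rV[R]_k) := \sum_i t 0 i.
  have Sc : sm t @[t --> c] --> sm c := sumc c.
  have S1 : (1 + sm t) @[t --> c] --> 1 + sm c by exact: (cvgD (@cvg_cst R 1 _ (nbhs c) _) Sc).
  have S2 : (1 - sm t) @[t --> c] --> 1 - sm c by exact: (cvgB (@cvg_cst R 1 _ (nbhs c) _) Sc).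
  have S3 : (1 + sm t + `|1 - sm t|) @[t --> c] --> 1 + sm c + `|1 - sm c|.
    by exact: (cvgD S1 (cvg_norm S2)).
  by exact: (cvgM S3 (@cvg_cst R 2^-1 _ (nbhs c) _)).
have Ac : continuous A.
  move=> c; have mc := mxc c.
  have H1 : (mx t)^-1 @[t --> c] --> (mx c)^-1.
    by exact: (cvgV (lt0r_neq0 (mx0 c)) mc).
  have H2 : (\sum_i (t : 'rV[R]_k) 0 i *: a i) @[t --> c] --> \sum_i c 0 i *: a i.
    apply: (@cvg_big X 'I_k +%R 0 xpredT (@add_continuous X) _ (nbhs c) (index_enum _)
      (fun i (t : 'rV[R]_k) => t 0 i *: a i) (fun i => c 0 i *: a i)) => i _.
    have H3 : (t : 'rV[R]_k) 0 i @[t --> c] --> c 0 i := coordc i c.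
    by exact: (cvgZ H3 (@cvg_cst X (a i) _ (nbhs c) _)).
  by exact: (cvgZ H1 H2).
have fc : continuous f.
  by apply: (lipschitz_continuous_map R X Y f 1) => x y; rewrite mul1r.
have finvc : continuous finv by exact: (lipschitz_continuous_map R Y X finv M).
pose g c := f (m + A c) - f m.
have gc : continuous g.
  have H1 := continuous_after f _ fc (continuous_translate A m 0 Ac).
  have -> : g = (fun c => 0 + f (m + A c - 0) - f m).
    by apply/funext => c; rewrite add0r subr0.
  exact: (continuous_translate _ 0 (f m) H1).
have eC : 0 < e / C by exact: divr_gt0.
have [l [p [_ pU]]] : exists l (p : 'I_l -> 'rV[R]_k), (forall i, cube k (p i)) /\
    forall c, cube k c -> exists i, `|g (p i) - g c| < e / C.
  apply: (compact_finite_pick _ (cube k) (fun c => [set c' | `|g c - g c'| < e / C])).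
    exact: cube_compact.
  by move=> c _; have /cvgrPdist_lt /(_ _ eC) := gc c.
exists (range (fun x : 'I_l -> R => \sum_i x i *: g (p i))); split.
  by exists l, (fun i => g (p i)).
move=> w hw wC wE y yb.
pose T x := finv (y + f (m + x)) - m.
have TA x : `|T x - x| <= M * b.
  have -> : T x - x = finv (y + f (m + x)) - finv (f (m + x)).
    by rewrite fK /T opprD addrA.
  apply: le_trans (finvL _ _) _; rewrite addrK; exact: ler_wpM2l.
pose x c := T (A c).
have xc : continuous x.
  have H1 := continuous_after f _ fc (continuous_translate A m 0 Ac).
  have H2 := continuous_after finv _ finvc (continuous_translate _ y 0 H1).
  have -> : x = (fun c => 0 + finv (y + f (m + A c - 0) - 0) - m).
    by apply/funext => c; rewrite add0r !subr0.
  exact: (continuous_translate _ 0 m H2).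
pose q c := fun i => phi i (x c).
pose s i c := Phi (q c) (a i) + M * b * nrm N (Phi (q c)).
have phic i : continuous (phi i).
  apply: (lipschitz_continuous_map R X R^o (phi i) (nrm N (phi i))) => u v.
  by rewrite -(scalarB _ (dphi i).1); exact: (nrm_ub N hN).
have qc i : continuous (fun c => q c i).
  exact: (continuous_after (phi i : X -> R^o) x (phic i) xc).
have nPhi c c' : nrm N (Phi (q c')) <= nrm N (Phi (q c)) +
    \sum_i `|q c' i - q c i| * nrm N (phi i) by exact: (nrm_sum_dist n phi dphi).
have sc i : continuous (s i).
  move=> c.
  have H1 : (\sum_j q t j * phi j (a i)) @[t --> c] --> \sum_j q c j * phi j (a i).
    apply: (@cvg_big R 'I_n +%R 0 xpredT (@add_continuous R) _ (nbhs c) (index_enum _)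
      (fun j (t : 'rV[R]_k) => q t j * phi j (a i)) (fun j => q c j * phi j (a i))) => j _.
    by exact: (cvgM (qc j c) (@cvg_cst R (phi j (a i)) _ (nbhs c) _)).
  have H2 : nrm N (Phi (q t)) @[t --> c] --> nrm N (Phi (q c)); last first.
    by exact: (cvgD H1 (cvgM (@cvg_cst R (M * b) _ (nbhs c) _) H2)).
  apply: (@cvgrPdist_lt R R 'rV[R]_k (nbhs c) (nbhs_filter c) _ _).2 => ep ep0.
  have S0 := @cvg_sum0 R 'rV[R]_k n (fun j t => `|q t j - q c j|)
    (fun j => nrm N (phi j)) c
    (fun j => @cvg_dist0 R 'rV[R]_k (fun t => q t j) c (qc j)).
  have nb : nbhs c [set t | \sum_j `|q t j - q c j| * nrm N (phi j) < ep].
    by exact: (cvgr_lt _ S0 _ ep0).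
  apply: (@filterS _ (nbhs c) _ _ _ _ nb) => c' /= Sv.
  rewrite ltr_norml; apply/andP; split.
    by have := nPhi c c'; lra.
  have := nPhi c' c; under eq_bigr do rewrite distrC.
  lra.
have [c [cc cP]] := cube_complementarity R k s sc.
have c0 i : 0 <= c 0 i by have /andP[] := cc i.
have hphi i := (dphi i).1.
have hPhi u : scalar (Phi u) by exact: scalar_sumf.
have dPhi u : dual N (Phi u) by exact: dual_sum.
have S0 : 0 <= \sum_i c 0 i by apply: sumr_ge0.
have xq i : phi i (x c) = 0.
  apply: contrapT => qi.
  have [j sj] := aP (q c) (ex_intro _ i qi).
  have cj : c 0 j = 1 by case: (cP j).2 => // /(lt_le_trans sj); rewrite ltxx.
  have S1 : 1 <= \sum_i c 0 i.
    by rewrite -cj (bigD1 j) //= lerDl; apply: sumr_ge0.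
  set u := Phi (q c).
  have uA : u (A c) <= - (M * b * nrm N u).
    rewrite /A (scalarZ u (hPhi _)) (scalar_sum u (hPhi _)) mxE' //.
    rewrite ler_pdivrMl; last exact: lt_le_trans S1.
    rewrite mulr_suml; apply: ler_sum => l' _.
    rewrite (scalarZ u (hPhi _)); case: (cP l').1 => [->|sl]; first by rewrite !mul0r.
    apply: ler_wpM2l => //; move: sl; rewrite /s -/u; lra.
  have uv : u (x c - A c) <= nrm N u * (M * b).
    apply: le_trans (ler_norm _) _; apply: le_trans (nrm_ub N hN u _ (dPhi _)) _.
    by apply: ler_wpM2l; [exact: (nrm_ge0 N hN u (dPhi _)) | exact: TA].
  have ux : u (x c) <= 0.
    by rewrite -(subrK (A c) (x c)) (scalarD u (hPhi _)); lra.
  have : 0 < u (x c).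
    rewrite /u /Phi (bigD1 i) //= ltr_pwDl //.
      by rewrite -expr2 exprn_even_gt0 //=; apply/eqP.
    by apply: sumr_ge0 => l' _; rewrite -expr2 sqr_ge0.
  by move=> /lt_le_trans /(_ ux); rewrite ltxx.
exists (x c); split; first exact: SP.
  have -> : x c = A c + (x c - A c) by rewrite addrC subrK.
  apply: le_trans (ler_normD _ _) _.
  have An : `|A c| <= d.
    rewrite normrZ ger0_norm ?invr_ge0 ?(ltW (mx0 _)) // ler_pdivrMl //.
    apply: le_trans (ler_norm_sum _ _ _) _.
    apply: le_trans (_ : (\sum_i c 0 i) * d <= _); last by rewrite ler_pM2r.
    rewrite mulr_suml; apply: ler_sum => i _; rewrite normrZ ger0_norm //.
    exact: ler_wpM2l.
  have := TA (A c); rewrite -/(x c) => TAc; lra.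
have -> : f (m + x c) = y + f (m + A c).
  by rewrite /x /T addrC subrK finvK.
rewrite -addrA (scalarD _ hw) lerD2l -/(g c).
have [i gi] := pU c cc.
have Eg : w (g (p i)) = 0.
  apply: wE; exists (fun j => (j == i)%:R) => //.
  rewrite (bigD1 i) //= eqxx scale1r big1 ?addr0 // => j /negbTE ->.
  by rewrite scale0r.
have -> : w (g c) = - w (g (p i) - g c) by rewrite (scalarB w hw (g (p i)) (g c)) Eg sub0r opprK.
apply: le_trans (ler_norm _) _; rewrite normrN; apply: le_trans (wC _) _.
by rewrite mulrC -ler_pdivlMr // ltW.
Qed.

End Gorelik.

(** * The renorming *)

Lemma Lip_le (R : realType) (V W : normedModType R) (g : V -> W) (k : R) :
  (Lip g <= k%:E)%E -> 0 <= k /\ forall x y, `|g x - g y| <= k * `|x - y|.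
Proof.
move=> gk.
have near_k e : 0 < e -> exists r, [/\ 0 <= r, r < k + e &
    forall x y, `|g x - g y| <= r * `|x - y|].
  move=> e0; have /ereal_inf_lt[_ [r [r0 gr] <-]] : (Lip g < (k + e)%:E)%E.
    by apply: le_lt_trans gk _; rewrite lte_fin ltrDl.
  rewrite lte_fin => rk; exists r; split=> // x y.
  exact: (gr (x, y) (conj I I)).
split=> [|x y]; apply/ler_addgt0Pr => e e0.
  by have [r [r0 rk _]] := near_k e e0; apply: le_trans r0 (ltW rk).
have c0 : 0 < `|x - y| + 1 by rewrite ltr_wpDl.
have [r [r0 rk gr]] := near_k _ (divr_gt0 e0 c0).
apply: le_trans (gr x y) _.
have H : r * `|x - y| <= (k + e / (`|x - y| + 1)) * `|x - y|.
  by apply: ler_wpM2r => //; exact: ltW.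
apply: le_trans H _; rewrite mulrDl lerD2l -mulrA ler_piMr ?(ltW e0) //.
by rewrite mulrC ler_pdivrMr // mul1r lerDl.
Qed.

Lemma le_ereal_by_reals (R : realType) (x y : \bar R) :
  (forall r : R, (r%:E < x)%E -> (r%:E <= y)%E) -> (x <= y)%E.
Proof.
move=> H; rewrite leNgt; apply/negP => yx.
case: y x H yx => [y||] [x||] H //= yx.
- have : (((x + y) / 2)%:E <= y%:E)%E by apply: H; move: yx; rewrite !lte_fin; lra.
  by move: yx; rewrite lte_fin lee_fin; lra.
- by have := H (y + 1) (ltry _); rewrite lee_fin; lra.
- have := H (x - 1); rewrite lte_fin ltrBlDr ltrDl ltr01 => /(_ isT).
  by rewrite leNgt ltNyr.
- by have := H 0 (ltry _); rewrite leNgt ltNyr.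
Qed.

Lemma lt_ereal_real (R : realType) (r : R) (x : \bar R) : (r%:E < x)%E ->
  exists2 r', r < r' & (r'%:E < x)%E.
Proof.
case: x => [x||] //.
- by rewrite lte_fin => rx; exists ((r + x) / 2); rewrite ?lte_fin; lra.
- by move=> _; exists (r + 1); [lra|exact: ltry].
Qed.

Lemma fin_dim_add (R : realType) (V : lmodType R) (E : set V) (y : V) :
  fin_dim_subspace E -> exists E', [/\ fin_dim_subspace E', E `<=` E' & E' y].
Proof.
move=> [n [e ->]]; pose e' i := oapp e y (unlift ord0 i).
exists (range (fun a : 'I_n.+1 -> R => \sum_i a i *: e' i)); split.
- by exists n.+1, e'.
- move=> _ [a _ <-]; exists (fun i => oapp a 0 (unlift ord0 i)) => //.
  rewrite big_ord_recl /e' unlift_none /= scale0r add0r.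
  by apply: eq_bigr => i _; rewrite liftK.
- exists (fun i => (i == ord0)%:R) => //.
  rewrite big_ord_recl /e' unlift_none /= ?eqxx scale1r big1 ?addr0 // => i _.
  by rewrite scale0r.
Qed.

Section ThetaBar.
Context {R : realType} {V : lmodType R}.
Variable N : V -> R.
Hypothesis hN : is_norm N.

(** If no [w] satisfies the hypotheses, the infimum is [+oo]. *)
Lemma theta_bar_at_ge z t (r : R) E : dual N z -> fin_dim_subspace E ->
  (forall w, annihilator N E w -> nrm N w = 1 ->
     1 + r <= nrm N (fun x => z x + t * w x)) ->
  (r%:E <= theta_bar_at N z t)%E.
Proof.
move=> dz fE H; apply: le_ereal_sup_tmp; eexists; first by exists E.
apply: le_ereal_inf_tmp => _ [w [aw /(dual_sphereE N hN)[dw w1]] <-].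
rewrite (dual_normE N hN); last exact: dual_comb.
by rewrite -EFinB lee_fin; have := H w aw w1; lra.
Qed.

Lemma theta_bar_asym_convex s (th : R) : s != 0 -> (th%:E < theta_bar N s)%E ->
  asym_convex N s th.
Proof.
move=> s0; rewrite /theta_bar (negbTE s0) => ths z dz z1.
have sz : dual_sphere N z by apply/(dual_sphereE N hN).
have : (th%:E < theta_bar_at N z s)%E.
  by apply: lt_le_trans ths _; apply: ereal_inf_lbound; exists z.
move=> /ereal_sup_gt[_ [E fE <-] thE]; exists E; split=> // w aw w1.
have : (th%:E <= dual_norm N (fun x => (z x + s * w x)%R) - 1)%E.
  apply: ltW; apply: lt_le_trans thE _; apply: ereal_inf_lbound; exists w => //.
  by split=> //; apply/(dual_sphereE N hN); split=> //; exact: aw.1.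
rewrite (dual_normE N hN); last by apply: dual_comb => //; exact: aw.1.
by rewrite -EFinB lee_fin; lra.
Qed.

(** Weak-star lower semicontinuity of the dual norm: take for [E] a line on which
    [z] is almost normed. *)
Lemma theta_bar_at_ge0 z t (r : R) : dual N z -> nrm N z = 1 -> r < 0 ->
  (r%:E <= theta_bar_at N z t)%E.
Proof.
move=> dz z1 r0; have nr0 : 0 < - r by lra.
have [x x1 zx] := nrm_adherent N hN z _ dz nr0.
apply: (theta_bar_at_ge z t r (range (fun a : 'I_1 -> R => \sum_i a i *: x))) => //.
  by exists 1%N, (fun=> x).
move=> w [dw wE] _; have wx : w x = 0.
  by apply: wE; exists (fun=> 1) => //; rewrite big_ord_recl big_ord0 scale1r addr0.
have dzw : dual N (fun x => z x + t * w x) by exact: dual_comb.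
have := nrm_ub N hN _ x dzw; rewrite wx mulr0 addr0 => H.
have H2 : nrm N (fun x => z x + t * w x) * N x <= nrm N (fun x => z x + t * w x).
  by rewrite ler_piMr // (nrm_ge0 N hN).
by have := ler_norm (z x); rewrite z1 in zx; lra.
Qed.

End ThetaBar.

Section Renorming.
Context {R : realType} {X Y : normedModType R}.
Variables (f : X -> Y) (finv : Y -> X) (M : R).
Hypotheses (fK : cancel f finv) (finvK : cancel finv f).
Hypothesis fL : forall x y, `|f x - f y| <= `|x - y|.
Hypothesis finvL : forall x y, `|finv x - finv y| <= M * `|x - y|.
Hypothesis M0 : 0 <= M.

Local Notation NX := (fun x : X => `|x|).

Definition lip_dual : set (Y -> R) :=
  [set u | scalar u /\ forall p q, u (f p) - u (f q) <= `|p - q|].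

(** The norm whose dual norm is the Lipschitz constant of [u \o f]. *)
Definition lip_norm (y : Y) : R := sup [set u y | u in lip_dual].

Lemma lip_dual_bound u y : lip_dual u -> u y <= M * `|y|.
Proof.
move=> [hu uL]; have := uL (finv y) (finv 0); rewrite !finvK (scalar0 _ hu) subr0.
by move=> H; apply: le_trans H _; have := finvL y 0; rewrite subr0.
Qed.

Lemma lip_dualN u : lip_dual u -> lip_dual (fun y => - u y).
Proof.
move=> [hu uL]; split=> [a x y|p q]; first by rewrite hu; ring.
by have := uL q p; rewrite distrC; lra.
Qed.

Lemma lip_dual0 : lip_dual (fun=> 0).
Proof. by split=> [a x y|p q]; rewrite ?mulr0 ?addr0 // subrr. Qed.

Lemma le_lip_norm u y : lip_dual u -> u y <= lip_norm y.
Proof.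
move=> du; apply: ub_le_sup; last by exists u.
by exists (M * `|y|) => _ [v dv <-]; exact: lip_dual_bound.
Qed.

Lemma lip_norm_le y c : (forall u, lip_dual u -> u y <= c) -> lip_norm y <= c.
Proof.
move=> H; apply: ge_sup; last by move=> _ [u du <-]; exact: H.
by exists 0, (fun=> 0) => //; exact: lip_dual0.
Qed.

Lemma lip_norm_ge y : `|y| <= lip_norm y.
Proof.
have [u [hu ub <-]] := hahn_banach_norming _ y (normr_is_norm R Y).
apply: le_lip_norm; split=> // p q; rewrite -(scalarB _ hu).
by apply: le_trans (ler_norm _) _; apply: le_trans (ub _) (fL p q).
Qed.

Lemma lip_norm_leM y : lip_norm y <= M * `|y|.
Proof. by apply: lip_norm_le => u; exact: lip_dual_bound. Qed.

Lemma lip_norm_diff p q : lip_norm (f p - f q) <= `|p - q|.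
Proof. by apply: lip_norm_le => u [hu uL]; rewrite (scalarB _ hu). Qed.

Lemma lip_norm_is_norm : is_norm lip_norm.
Proof.
have pos y : 0 <= lip_norm y by apply: le_trans (lip_norm_ge y).
have N0 : lip_norm 0 = 0.
  by apply/eqP; rewrite eq_le pos andbT; have := lip_norm_leM 0; rewrite normr0 mulr0.
have Zle a y : lip_norm (a *: y) <= `|a| * lip_norm y.
  apply: lip_norm_le => u du; rewrite (scalarZ _ du.1).
  have [a0|a0] := leP 0 a.
    by rewrite (ger0_norm a0) ler_wpM2l //; exact: le_lip_norm.
  rewrite (ltr0_norm a0).
  have := le_lip_norm _ y (lip_dualN _ du) => H.
  have : - a * - u y <= - a * lip_norm y by apply: ler_wpM2l => //; lra.
  by rewrite mulrNN.
split=> //.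
- by move=> y y0; apply/eqP; rewrite -normr_le0 -y0 lip_norm_ge.
- move=> x y; apply: lip_norm_le => u du; rewrite (scalarD _ du.1).
  by apply: lerD; exact: le_lip_norm.
- move=> a y; apply/eqP; rewrite eq_le Zle /=.
  have [->|a0] := eqVneq a 0; first by rewrite scale0r normr0 mul0r N0.
  rewrite -ler_pdivlMl ?normr_gt0 // -normfV.
  by have := Zle a^-1 (a *: y); rewrite scalerA mulVf // scale1r.
Qed.

Local Notation N := lip_norm.
Let hN := lip_norm_is_norm.

(** This lemma and the next one say that the dual norm of [lip_norm] at [u] is
    the Lipschitz constant of [u \o f]. *)
Lemma lip_sphere_lip u : dual N u -> nrm N u = 1 ->
  forall p q, u (f p) - u (f q) <= `|p - q|.
Proof.
move=> du u1 p q; rewrite -(scalarB _ du.1); apply: le_trans (ler_norm _) _.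
apply: le_trans (nrm_ub N hN u _ du) _; rewrite u1 mul1r; exact: lip_norm_diff.
Qed.

Lemma lip_sphere_sup u : dual N u -> nrm N u = 1 -> forall e : R, 0 < e ->
  exists p q, (1 - e) * `|p - q| < u (f p) - u (f q).
Proof.
move=> du u1 e e0; apply: contrapT => H.
pose e' := Num.min e 2^-1.
have e'0 : 0 < e' by rewrite lt_min e0 /=; lra.
have e'2 : e' <= 2^-1 by rewrite ge_min lexx orbT.
have e'1 : 0 < 1 - e' by lra.
have uL p q : u (f p) - u (f q) <= (1 - e') * `|p - q|.
  have h1 : u (f p) - u (f q) <= (1 - e) * `|p - q|.
    by rewrite leNgt; apply/negP => h; apply: H; exists p, q.
  apply: le_trans h1 _; apply: ler_wpM2r => //.
  by rewrite lerD2l lerN2 ge_min lexx.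
have dv : lip_dual (fun y => (1 - e')^-1 * u y).
  split=> [a x y|p q]; first by rewrite du.1; ring.
  by rewrite -mulrBr ler_pdivrMl.
suff : nrm N u <= 1 - e' by rewrite u1; lra.
apply: (nrm_le N hN) => [|x]; first exact: ltW.
rewrite ler_norml; apply/andP; split.
  have := le_lip_norm _ x (lip_dualN _ dv); rewrite -mulrN ler_pdivrMl //; lra.
by have := le_lip_norm _ x dv; rewrite ler_pdivrMl.
Qed.

Section Estimate.
Variables (t s th : R).
Hypotheses (t0 : 0 < t) (t1 : t <= 1) (M1 : 1 <= M) (sE : s = t / (4 * M)).
Hypotheses (th0 : 0 < th) (cvx : asym_convex NX s th).

Let Mp : 0 < M. Proof. exact: lt_le_trans M1. Qed.
Let s0 : 0 < s. Proof. by rewrite sE divr_gt0 // mulr_gt0. Qed.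
Let s4 : s <= 4^-1.
Proof.
rewrite sE ler_pdivrMr ?mulr_gt0 // mulrA mulVf ?gt_eqF // mul1r.
exact: le_trans t1 M1.
Qed.

(** The comparison of [m + v] with [m + z] described at the top; [ep] is the common
    value of all the errors, chosen so that they do not exhaust the difference
    between [1 + 2 th] and [(1 + th) (1 + th - sg th)]. *)
Lemma renorming_estimate z : dual N z -> nrm N z = 1 -> th <= s ->
  (th%:E <= theta_bar_at N z t)%E.
Proof.
have Mp' := Mp; have s0' := s0; have s4' := s4; have th0' := th0; have t1' := t1.
move=> dz z1 ths; pose sg := th / s.
have sg0 : 0 < sg by exact: divr_gt0.
have sg1 : sg <= 1 by rewrite ler_pdivrMr // mul1r.
have sgs : sg * s = th by rewrite /sg divfK // gt_eqF.
have sgth : 0 < sg - th.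
  have -> : sg - th = sg * (1 - s) by rewrite mulrBr mulr1 sgs.
  by rewrite mulr_gt0 //; lra.
pose ep := th * (sg - th) / (4 + 5 * th).
have c0 : 0 < 4 + 5 * th by lra.
have ep0 : 0 < ep by rewrite divr_gt0 // mulr_gt0.
have epE : ep * (4 + 5 * th) = th * (sg - th) by rewrite /ep divfK // gt_eqF.
have ep1 : ep < 1.
  rewrite ltr_pdivrMr // mul1r; apply: le_lt_trans (_ : th * 1 < _); last lra.
  by rewrite ler_pM2l //; lra.
have hL p q : z (f p) - z (f q) <= `|p - q| by exact: lip_sphere_lip.
have hsup := lip_sphere_sup z dz z1.
have [m [v [v0 hv cz]]] := good_point NX (normr_is_norm R X) s th s0' s4' th0 ths cvx
  (fun p => z (f p)) hL hsup ep ep ep0 ep0.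
set l := `|v| in v0 hv cz.
have epl : 0 < ep * l by exact: mulr_gt0.
have := asymptotic_growth NX (normr_is_norm R X) s th s0' th0 ths cvx (- v) (ep * l) epl.
rewrite normrN -/l => gz.
pose d := sg * l / 2; pose b := (1 - ep) * d / M.
have d0 : 0 < d by rewrite divr_gt0 // mulr_gt0.
have b0 : 0 <= b by rewrite divr_ge0 ?(ltW Mp') // mulr_ge0 ?(ltW d0) //; lra.
have Mbd : M * b < d.
  rewrite /b mulrC divfK ?gt_eqF // gtr_pMl //; lra.
have [E1 [fE1 HE1]] := gorelik f finv M fK finvK fL finvL M0 _ m b d M (ep * l)
  (fin_codimI _ _ _ cz gz) b0 Mbd Mp' epl.
have [E [fE E1E Ev]] := fin_dim_add R Y E1 (f (m + v) - f m) fE1.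
apply: (theta_bar_at_ge N hN z t th E dz fE) => w [dw wE] w1.
have hw := dw.1.
have wM y : `|w y| <= M * `|y|.
  by apply: le_trans (nrm_ub N hN w y dw) _; rewrite w1 mul1r lip_norm_leM.
have [x x1 wx] := nrm_adherent N hN w ep dw ep0.
have xb : `|- b *: x| <= b.
  rewrite normrZ normrN ger0_norm // ler_piMr //.
  exact: le_trans (lip_norm_ge x) x1.
have [y [[y1 y2] yd wy]] := HE1 w hw wM (fun y Ey => wE y (E1E y Ey)) _ xb.
have yl : `|y| <= sg * l by apply: le_trans yd _; rewrite /d; lra.
have {}y1 := y1 yl; have {}y2 := y2 yl.
pose u y := z y + t * w y.
have du : dual N u by exact: dual_comb.
set nu := nrm N (fun x => z x + t * w x).
have nu0 : 0 <= nu by exact: (nrm_ge0 N hN).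
have up : u (f (m + v)) - u (f (m + y)) <= nu * (l * (1 + sg * (s - th)) + ep * l).
  rewrite -(scalarB _ du.1); apply: le_trans (ler_norm _) _.
  apply: le_trans (nrm_ub N hN u _ du) _; apply: ler_wpM2l => //.
  apply: le_trans (lip_norm_diff _ _) _.
  by rewrite opprD addrACA subrr add0r -normrN opprB addrC.
have wv : w (f (m + v)) = w (f m).
  by apply/eqP; rewrite -subr_eq0 -(scalarB _ hw) wE.
have wd : w (f (m + y)) - w (f m) <= - b * (1 - ep) + ep * l.
  rewrite -(scalarB _ hw); apply: le_trans wy _; rewrite lerD2r (scalarZ _ hw).
  rewrite !mulNr lerN2 ler_wpM2l //; rewrite w1 in wx; exact: ltW.
have tb : t * b = 2 * th * (1 - ep) * l.
  rewrite /b /d -sgs sE; field; exact: lt0r_neq0.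
have low : (1 - ep) * l - ep * l + (2 * th * (1 - ep) * l * (1 - ep) - ep * l) <=
    u (f (m + v)) - u (f (m + y)).
  have H : t * (w (f (m + y)) - w (f m)) <= t * (- b * (1 - ep) + ep * l).
    by rewrite ler_pM2l.
  have E2 : t * (- b * (1 - ep) + ep * l) = - (t * b * (1 - ep)) + t * (ep * l) by ring.
  have H2 : t * (ep * l) <= ep * l by rewrite ler_piMl // ltW.
  rewrite E2 tb in H; rewrite /u wv; lra.
rewrite leNgt; apply/negP => nu1.
have up2 : nu * (l * (1 + sg * (s - th)) + ep * l) <=
    (1 + th) * (l * (1 + sg * (s - th)) + ep * l).
  apply: ler_wpM2r; last exact: ltW.
  apply: addr_ge0; last exact: ltW.
  by rewrite mulr_ge0 ?(ltW v0) // addr_ge0 // mulr_ge0 ?(ltW sg0) ?subr_ge0.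
have := le_trans low (le_trans up up2).
have -> : (1 + th) * (l * (1 + sg * (s - th)) + ep * l) =
   ((1 + th) * (1 + sg * s - sg * th + ep)) * l by ring.
have -> : (1 - ep) * l - ep * l + (2 * th * (1 - ep) * l * (1 - ep) - ep * l) =
   (1 - 3 * ep + 2 * th * (1 - ep) * (1 - ep)) * l by ring.
rewrite ler_pM2r // sgs.
have p1 : 0 < th * ep * ep by exact: mulr_gt0 (mulr_gt0 th0 ep0) ep0.
have p2 : 0 < th * sg * th by exact: mulr_gt0 (mulr_gt0 th0 sg0) th0.
have E3 : (1 + th) * (1 + th - sg * th + ep) =
  1 + 2 * th + th * th - th * sg - th * sg * th + ep + ep * th by ring.
have E4 : 1 - 3 * ep + 2 * th * (1 - ep) * (1 - ep) =
  1 - 3 * ep + 2 * th - 4 * (ep * th) + 2 * (th * ep * ep) by ring.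
have E5 : ep * (4 + 5 * th) = 4 * ep + 5 * (ep * th) by ring.
rewrite E5 mulrBr in epE; rewrite E3 E4; lra.
Qed.

(** By the triangle inequality, the modulus at [s] exceeds [s] only if [E^perp] is
    trivial for some finite dimensional [E]. Then [0] is a subspace of finite
    codimension, and the Gorelik principle leaves no [w] of norm 1 in the
    annihilator of a suitable subspace of [Y]. *)
Lemma renorming_estimate_fin_dim (r : R) z : dual N z -> nrm N z = 1 -> s < th ->
  (r%:E <= theta_bar_at N z t)%E.
Proof.
have Mp' := Mp; have s0' := s0.
move=> dz z1 sth; have hX := normr_is_norm R X.
have [y y0] : exists y : Y, y <> 0.
  apply: contrapT => H; have : nrm N z <= 0.
    apply: (nrm_le N hN) => // y; have -> : y = 0 by apply: contrapT => yn; apply: H; exists y.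
    by rewrite (scalar0 _ dz.1) normr0 mul0r.
  by rewrite z1 ler10.
have [x x0] : exists x : X, x <> 0.
  apply: contrapT => H; apply: y0; rewrite -(finvK y) -(finvK 0).
  have z0 (p : X) : p = 0 by apply: contrapT => pn; apply: H; exists p.
  by rewrite (z0 (finv y)) (z0 (finv 0)).
have nx : 0 < `|x| by rewrite normr_gt0; apply/eqP.
have [u [du u1 ux]] := norming NX hX x.
have {}u1 : nrm NX u = 1.
  apply/eqP; rewrite eq_le u1 /=; have := nrm_ub NX hX u x du.
  by rewrite ux normr_id -{1}[`|x|]mul1r ler_pM2r.
have [E [fE EP]] := cvx u du u1.
have triv w : annihilator NX E w -> forall p, w p = 0.
  move=> aw p; have dw := aw.1; have wn := nrm_ge0 NX hX w dw.
  have [w0|w0] := eqVneq (nrm NX w) 0.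
    by apply/eqP; rewrite -normr_le0; have := nrm_ub NX hX w p dw; rewrite w0 mul0r.
  have dw' : dual NX (fun p => (nrm NX w)^-1 * w p) by exact: dualZ.
  have aw' : annihilator NX E (fun p => (nrm NX w)^-1 * w p).
    by split=> // q Eq; rewrite aw.2 // mulr0.
  have w'1 : nrm NX (fun p => (nrm NX w)^-1 * w p) = 1.
    by rewrite (nrmZ NX hX) // ger0_norm ?invr_ge0 // mulVf.
  have := EP _ aw' w'1; have := nrm_comb NX hX u _ s du dw'.
  by rewrite u1 w'1 mulr1 (gtr0_norm s0'); lra.
have [n [e [psi [dpsi eP]]]] := fin_dim_projection NX hX E fE.
have cof : fin_codim NX [set 0].
  exists n, psi; split=> // p pp /=.
  have [g [dg _ gp]] := norming NX hX p.
  apply/eqP; rewrite -normr_eq0 -gp.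
  pose g' q := g q + (-1) * \sum_i g (e i) * psi i q.
  have dg' : dual NX g' by apply: dual_comb => //; exact: dual_sum.
  have ag' : annihilator NX E g'.
    split=> // q Eq; rewrite /g' {1}(eP _ Eq) (scalar_sum _ dg.1) mulN1r.
    apply/eqP; rewrite subr_eq0; apply/eqP; apply: eq_bigr => i _.
    by rewrite (scalarZ _ dg.1) mulrC.
  have := triv g' ag' p; rewrite /g' big1 ?mulr0 ?addr0 => [->//|i _].
  by rewrite pp mulr0.
have half : 0 < 4^-1 :> R by rewrite invr_gt0.
have M1lt : M * 1 < M + 1 by rewrite mulr1 ltrDl.
have [E1 [fE1 HE1]] := gorelik f finv M fK finvK fL finvL M0 _ 0 1 (M + 1) M (4^-1)
  cof ler01 M1lt Mp' half.
apply: (theta_bar_at_ge N hN z t r E1 dz fE1) => w [dw wE] w1.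
have wM q : `|w q| <= M * `|q|.
  by apply: le_trans (nrm_ub N hN w q dw) _; rewrite w1 mul1r lip_norm_leM.
have [p p1 wp] := nrm_adherent N hN w (4^-1) dw half.
have pb : `|- p| <= 1 by rewrite normrN; exact: le_trans (lip_norm_ge p) p1.
have [q [/= -> _]] := HE1 w dw.1 wM wE _ pb.
rewrite addr0 subrr (scalar0 _ dw.1) (scalarN _ dw.1); rewrite w1 in wp; lra.
Qed.

End Estimate.
End Renorming.

(** When [t != 0], the existence of a functional of norm 1 on [Y] forces [1 <= M],
    hence [s <= 1 / 4], which the estimates use. *)
Theorem theorem6p3 (R : realType) (X Y : completeNormedModType R)
    (f : X -> Y) (finv : Y -> X) (M : R)
    (fK : cancel f finv) (finvK : cancel finv f)
    (Lip_f : (Lip f <= 1%:E)%E) (Lip_finv : (Lip finv <= M%:E)%E) :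
  exists N : Y -> R,
    [/\ is_norm N,
        equivalent_norms (fun y : Y => `|y|) N,
        forall y : Y, `|y| <= N y <= M * `|y|
      & forall t : R, 0 <= t <= 1 ->
          (theta_bar (fun x : X => `|x|%R) (t / (4 * M))%R <= theta_bar N t)%E].
Proof.
have [_ fL1] := Lip_le R X Y f 1 Lip_f.
have fL x y : `|f x - f y| <= `|x - y| by have := fL1 x y; rewrite mul1r.
have [M0 finvL] := Lip_le R Y X finv M Lip_finv.
have hN := lip_norm_is_norm f finv M finvK fL finvL.
have lo := lip_norm_ge f finv M finvK fL finvL.
have up := lip_norm_leM f finv M finvK finvL.
exists (lip_norm f); split=> //.
- exists 1, (M + 1); split=> [//||y]; first lra.
  rewrite mul1r lo /=; apply: le_trans (up y) _; rewrite ler_wpM2r //; lra.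
- by move=> y; rewrite lo up.
move=> t /andP[t0 t1]; rewrite {2}/theta_bar.
have [->|tN0] := eqVneq t 0; first by rewrite mul0r /theta_bar eqxx.
have tp : 0 < t by rewrite lt_neqAle eq_sym tN0.
apply: le_ereal_inf_tmp => _ [z /(dual_sphereE _ hN)[dz z1] <-].
have M1 : 1 <= M.
  have [x x1 zx] := nrm_adherent _ hN z 1 dz ltr01.
  rewrite z1 subrr in zx.
  have nx : 0 < `|x|.
    by rewrite normr_gt0; apply: contraTneq zx => ->; rewrite (scalar0 _ dz.1) ltxx.
  by rewrite -(ler_pM2r nx) mul1r; exact: le_trans (lo x) (up x).
apply: le_ereal_by_reals => r rth.
have [r0|r0] := ltP r 0; first exact: theta_bar_at_ge0.
have [th rth' thX] := lt_ereal_real _ _ _ rth.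
have th0 : 0 < th by exact: le_lt_trans rth'.
have sN0 : t / (4 * M) != 0.
  by rewrite mulf_neq0 // invr_eq0 mulf_neq0 // gt_eqF // (lt_le_trans ltr01).
have cvx := theta_bar_asym_convex _ (normr_is_norm R X) _ th sN0 thX.
have [ths|sth] := leP th (t / (4 * M)).
  apply: le_trans (_ : (th%:E <= _)%E); first by rewrite lee_fin ltW.
  exact: (renorming_estimate f finv M fK finvK fL finvL M0 t _ th tp t1 M1 erefl th0 cvx).
exact: (renorming_estimate_fin_dim f finv M fK finvK fL finvL M0 t _ th tp M1 erefl cvx).
Qed.
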